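(* Let $R$ be a one-dimensional analytically reduced semilocal Cohen–Macaulay ring with large residue fields. Then $$\Gamma_{\mathcal{E}}=\Gamma_{\widehat{\mathcal{E}}}$$ for any regular fractional ideal $\mathcal{E}\in\mathfrak{R}_R$.
   Context: All rings are commutative and unitary; $\operatorname{Max}(R)$ is the set of maximal ideals of $R$. A one-dimensional Noetherian ring $R$ is Cohen–Macaulay if $\operatorname{depth}(R_{\mathfrak m})=1$ for all $\mathfrak m\in\operatorname{Max}(R)$. $\widehat{M}$ denotes completion of an $R$-module $M$ at the Jacobson radical of $R$; for $\mathcal{E}\in\mathfrak{R}_R$ one has $\widehat{\mathcal{E}}=\mathcal{E}\widehat{R}$, a regular fractional ideal of $\widehat{R}$. $Q_R$ is the total ring of fractions of $R$, $Q_R^{\mathrm{reg}}$ the set of its regular elements, and $T^{\mathrm{reg}}:=T\cap Q_R^{\mathrm{reg}}$ for $T\subseteq Q_R$. A fractional ideal of $R$ is an $R$-submodule $\mathcal{E}\subseteq Q_R$ with $r\mathcal{E}\subseteq R$ for some $r\in R^{\mathrm{reg}}$; it is regular if $\mathcal{E}^{\mathrm{reg}}\ne\emptyset$. $\mathfrak{R}_R$ is the set of regular fractional ideals. Let $R$ be a one-dimensional semilocal Cohen–Macaulay ring. Then so is $\widehat R$. $\mathfrak{V}_R$ is the set of valuation rings of $Q_R$ over $R$, i.e. subrings $V$ with $R\subseteq V\subsetneq Q_R$ such that $Q_R\setminus V$ is multiplicatively closed. This set is finite and nonempty; each $V\in\mathfrak{V}_R$ is a discrete valuation ring in the sense that it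 has a unique regular maximal ideal $\mathfrak{m}_V$, which is invertible and is the only regular prime ideal of $V$; moreover $\mathfrak{m}_V\cap R\in\operatorname{Max}(R)$. The associated discrete valuation $\nu_V\colon Q_R\to\mathbb{Z}\cup\{\infty\}$ is $\nu_V(x)=\max\{k\in\mathbb{Z}\mid x\in\mathfrak{m}_V^k\}$, with $\nu_V(x)=\infty$ if $x\in\bigcap_k\mathfrak{m}_V^k$. Set $\nu=(\nu_V)_{V\in\mathfrak{V}_R}$ and, for $\mathcal{E}\in\mathfrak{R}_R$, $\Gamma_{\mathcal{E}}:=\nu(\mathcal{E}^{\mathrm{reg}})\subseteq\mathbb{Z}^{\mathfrak{V}_R}$. The ring $R$ is analytically reduced if $\widehat{R}$ is reduced (then $R$ is reduced); it has large residue fields if $|R/\mathfrak{m}|\ge|\mathfrak{V}_{R_{\mathfrak{m}}}|$ for all $\mathfrak{m}\in\operatorname{Max}(R)$. Identifications used to compare subsets of $\mathbb{Z}^{\mathfrak{V}_R}$ and $\mathbb{Z}^{\mathfrak{V}_{\widehat{R}}}$: if $R$ is local, there is a bijection $\mathfrak{V}_R\to\mathfrak{V}_{\widehat{R}}$, $V\mapsto V\widehat{R}$, with inverse $W\mapsto W\cap Q_R$. If $R$ is reduced semilocal, there is a bijection $\mathfrak{V}_R\to\bigsqcup_{\mathfrak{m}\in\operatorname{Max}(R)}\mathfrak{V}_{R_{\mathfrak{m}}}$, $V\mapsto V_{\mathfrak{m}_V\cap R}$. For $R$ analytically reduced semilocal, $\widehat{R}=\prod_{\mathfrak{m}\in\operatorname{Max}(R)}\widehat{R_{\mathfrak{m}}}$,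 the factors being the localizations of $\widehat{R}$ at its maximal ideals, and combining these bijections identifies $\mathfrak{V}_R=\bigsqcup_{\mathfrak{m}}\mathfrak{V}_{R_{\mathfrak{m}}}=\bigsqcup_{\mathfrak{m}}\mathfrak{V}_{\widehat{R_{\mathfrak{m}}}}=\mathfrak{V}_{\widehat{R}}$ and hence $\mathbb{Z}^{\mathfrak{V}_R}=\mathbb{Z}^{\mathfrak{V}_{\widehat{R}}}$. *)

(* Defs.v *)
From HB Require Import structures.
From mathcomp Require Import all_boot all_order all_algebra.
From mathcomp Require Import generic_quotient ring.
From mathcomp Require Import boolp classical_sets functions cardinality.

Set Implicit Arguments.
Unset Strict Implicit.
Unset Printing Implicit Defensive.

Import Order.TTheory GRing.Theory Num.Theory.
Local Open Scope classical_set_scope.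
Local Open Scope ring_scope.
Local Open Scope quotient_scope.
Local Open Scope card_scope.

(* A commutative unitary ring, possibly zero, is a comPzRingType.  Subrings,
   submodules and ideals are subsets (type set T) of such a ring. *)

Definition regular (T : comPzRingType) : set T :=
  [set x | forall y, x * y = 0 -> y = 0].

(* A is meant to be a subring of T. *)
Definition submodule (T : comPzRingType) (A E : set T) : Prop :=
  [/\ E 0, forall x y, E x -> E y -> E (x + y)
    & forall a x, A a -> E x -> E (a * x)].

Definition add_span (T : comPzRingType) (X : set T) : set T :=
  smallest [set E : set T | E 0 /\ forall x y, E x -> E y -> E (x + y)] X.

Definition prod_ideal (T : comPzRingType) (I J : set T) : set T :=
  add_span [set z | exists x y, [/\ I x, J y & z = x * y]].

(* The power I^n of an ideal I of the subring A of T, with I^0 = A. *)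
Definition power (T : comPzRingType) (A I : set T) (n : nat) : set T :=
  iter n (prod_ideal I) A.

Definition ideal_of (T : comPzRingType) (A I : set T) : Prop :=
  I `<=` A /\ submodule A I.

Definition maximal_ideal_of (T : comPzRingType) (A M : set T) : Prop :=
  [/\ ideal_of A M, M <> A
    & forall I, ideal_of A I -> M `<=` I -> I = M \/ I = A].

Definition ideal (R : comPzRingType) (I : set R) : Prop := ideal_of setT I.

Definition prime_ideal (R : comPzRingType) (P : set R) : Prop :=
  [/\ ideal P, ~ P 1 & forall x y, P (x * y) -> P x \/ P y].

Definition Max (R : comPzRingType) : set (set R) :=
  [set M | maximal_ideal_of setT M].

Arguments Max R : clear implicits.

Definition jacobson (R : comPzRingType) : set R := \bigcap_(M in Max R) M.

Definition ideal_gen (R : comPzRingType) (s : seq R) : set R :=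
  prod_ideal setT [set x | x \in s].

Definition noetherian (R : comPzRingType) : Prop :=
  forall I : set R, ideal I -> exists s : seq R, I = ideal_gen s.

Definition reduced (R : comPzRingType) : Prop :=
  forall (x : R) n, x ^+ n = 0 -> x = 0.

(* P 0, ..., P n is a strict chain of primes, of length n. *)
Definition prime_chain (R : comPzRingType) (P : nat -> set R) (n : nat) : Prop :=
  (forall i, (i <= n)%N -> prime_ideal (P i)) /\
  (forall i, (i < n)%N -> P i `<` P i.+1).

Definition krull_dim (R : comPzRingType) (d : nat) : Prop :=
  (exists P : nat -> set R, prime_chain P d) /\
  (forall (P : nat -> set R) n, prime_chain P n -> (n <= d)%N).

Definition regular_sequence (R : comPzRingType) (s : seq R) : Prop :=
  (forall i, (i < size s)%N -> forall y,
     ideal_gen (take i s) (s`_i * y) -> ideal_gen (take i s) y) /\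
  ~ ideal_gen s 1.

(* For R local, whose maximal ideal is then jacobson R. *)
Definition local_depth (R : comPzRingType) (d : nat) : Prop :=
  let in_max (s : seq R) := forall x, x \in s -> @jacobson R x in
  (exists s : seq R, [/\ regular_sequence s, in_max s & size s = d]) /\
  (forall s : seq R, regular_sequence s -> in_max s -> (size s <= d)%N).

(* The denominators of the fractions in loc S are the elements of the
   multiplicative submonoid generated by S, so that S may be any subset; this
   submonoid is S itself if S consists of the regular elements, or is the
   complement of a prime ideal. *)
Section Loc.
Variables (R : comPzRingType) (S : set R).

Definition loc_denom : set R :=
  smallest [set M : set R | M 1 /\ forall x y, M x -> M y -> M (x * y)] S.

Lemma loc_denom1 : loc_denom 1.
Proof. by move=> M [[]]. Qed.

Lemma loc_denomM x y : loc_denom x -> loc_denom y -> loc_denom (x * y).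
Proof.
move=> dx dy M hM; have [_ MM] := hM.1.
by apply: MM; [exact: dx M hM|exact: dy M hM].
Qed.

Inductive ratio := Ratio { ratio_pair :> R * R; _ : `[< loc_denom ratio_pair.2 >] }.
HB.instance Definition _ := [isSub for ratio_pair].
HB.instance Definition _ := [Choice of ratio by <:].

Definition ratio_mk (a s : R) (ds : loc_denom s) : ratio := @Ratio (a, s) (asboolT ds).

Lemma ratio_denomP (x : ratio) : loc_denom x.2.
Proof. by case: x => x /= /asboolP. Qed.

Definition equivr (x y : ratio) : bool :=
  `[< exists2 u, loc_denom u & u * (x.1 * y.2) = u * (y.1 * x.2) >].

Lemma equivr_refl : reflexive equivr.
Proof. by move=> x; apply/asboolP; exists 1 => //; exact: loc_denom1. Qed.

Lemma equivr_sym : symmetric equivr.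
Proof. by move=> x y; apply/asboolP/asboolP => -[u du e]; exists u. Qed.

Lemma equivr_trans : transitive equivr.
Proof.
move=> y x z /asboolP[u du exy] /asboolP[v dv eyz]; apply/asboolP.
exists (u * v * y.2); first exact: loc_denomM (loc_denomM du dv) (ratio_denomP y).
transitivity (v * z.2 * (u * (x.1 * y.2))); first by ring.
rewrite exy; transitivity (u * x.2 * (v * (y.1 * z.2))); first by ring.
by rewrite eyz; ring.
Qed.

Canonical equivr_equiv := EquivRel equivr equivr_refl equivr_sym equivr_trans.

Definition loc := {eq_quot equivr}.
HB.instance Definition _ : EqQuotient _ equivr loc := EqQuotient.on loc.
HB.instance Definition _ := Choice.on loc.

Lemma loc_eqP (x y : ratio) : \pi_loc x = \pi_loc y <->
  exists2 u, loc_denom u & u * (x.1 * y.2) = u * (y.1 * x.2).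
Proof.
split=> [/eqmodP/asboolP //|h]; apply/eqmodP; exact/asboolP.
Qed.

Lemma loc_eq1 (x y : ratio) : x.1 * y.2 = y.1 * x.2 -> \pi_loc x = \pi_loc y.
Proof. by move=> e; apply/loc_eqP; exists 1; [exact: loc_denom1|rewrite e]. Qed.

Definition ratio_add (x y : ratio) : ratio :=
  ratio_mk (x.1 * y.2 + y.1 * x.2) (loc_denomM (ratio_denomP x) (ratio_denomP y)).
Definition ratio_opp (x : ratio) : ratio := ratio_mk (- x.1) (ratio_denomP x).
Definition ratio_mul (x y : ratio) : ratio :=
  ratio_mk (x.1 * y.1) (loc_denomM (ratio_denomP x) (ratio_denomP y)).
Definition ratio_of (a : R) : ratio := ratio_mk a loc_denom1.

Definition to_loc (a : R) : loc := \pi_loc (ratio_of a).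
Definition loc_zero : loc := to_loc 0.
Definition loc_one : loc := to_loc 1.
Definition loc_add : loc -> loc -> loc := lift_op2 loc ratio_add.
Definition loc_opp : loc -> loc := lift_op1 loc ratio_opp.
Definition loc_mul : loc -> loc -> loc := lift_op2 loc ratio_mul.

Lemma loc_reprP (x : ratio) : exists2 u, loc_denom u &
  u * (x.1 * (repr (\pi_loc x)).2) = u * ((repr (\pi_loc x)).1 * x.2).
Proof. by apply/loc_eqP; rewrite reprK. Qed.

Lemma loc_pi_opp : {morph \pi : x / ratio_opp x >-> loc_opp x}.
Proof.
move=> x; unlock loc_opp; apply/loc_eqP => /=; have [u du e] := loc_reprP x.
by exists u => //; rewrite !mulNr !mulrN e.
Qed.
Canonical loc_pi_opp_morph := PiMorph1 loc_pi_opp.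

Lemma loc_pi_add : {morph \pi : x y / ratio_add x y >-> loc_add x y}.
Proof.
move=> x y; unlock loc_add; apply/loc_eqP => /=.
have [u du] := loc_reprP x; have [v dv] := loc_reprP y.
move: (repr (\pi_loc x)) (repr (\pi_loc y)) => x' y' ey ex; exists (u * v); first exact: loc_denomM.
transitivity (v * y.2 * y'.2 * (u * (x.1 * x'.2)) +
              u * x.2 * x'.2 * (v * (y.1 * y'.2))); first by ring.
by rewrite ex ey; ring.
Qed.
Canonical loc_pi_add_morph := PiMorph2 loc_pi_add.

Lemma loc_pi_mul : {morph \pi : x y / ratio_mul x y >-> loc_mul x y}.
Proof.
move=> x y; unlock loc_mul; apply/loc_eqP => /=.
have [u du] := loc_reprP x; have [v dv] := loc_reprP y.
move: (repr (\pi_loc x)) (repr (\pi_loc y)) => x' y' ey ex; exists (u * v); first exact: loc_denomM.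
transitivity (u * (x.1 * x'.2) * (v * (y.1 * y'.2))); first by ring.
by rewrite ex ey; ring.
Qed.
Canonical loc_pi_mul_morph := PiMorph2 loc_pi_mul.

Lemma loc_addA : associative loc_add.
Proof.
elim/quotW=> x; elim/quotW=> y; elim/quotW=> z; rewrite !piE.
by apply: loc_eq1 => /=; ring.
Qed.

Lemma loc_addC : commutative loc_add.
Proof.
by elim/quotW=> x; elim/quotW=> y; rewrite !piE; apply: loc_eq1 => /=; ring.
Qed.

Lemma loc_add0 : left_id loc_zero loc_add.
Proof. by elim/quotW=> x; rewrite -?loc_pi_opp -?loc_pi_add -?loc_pi_mul; apply: loc_eq1 => /=; ring. Qed.

Lemma loc_addN : left_inverse loc_zero loc_opp loc_add.
Proof. by elim/quotW=> x; rewrite -?loc_pi_opp -?loc_pi_add -?loc_pi_mul; apply: loc_eq1 => /=; ring. Qed.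

HB.instance Definition _ := GRing.isZmodule.Build loc loc_addA loc_addC loc_add0 loc_addN.

Lemma loc_mulA : associative loc_mul.
Proof.
elim/quotW=> x; elim/quotW=> y; elim/quotW=> z; rewrite !piE.
by apply: loc_eq1 => /=; ring.
Qed.

Lemma loc_mulC : commutative loc_mul.
Proof.
by elim/quotW=> x; elim/quotW=> y; rewrite !piE; apply: loc_eq1 => /=; ring.
Qed.

Lemma loc_mul1 : left_id loc_one loc_mul.
Proof. by elim/quotW=> x; rewrite -?loc_pi_opp -?loc_pi_add -?loc_pi_mul; apply: loc_eq1 => /=; ring. Qed.

Lemma loc_mulD : left_distributive loc_mul loc_add.
Proof.
elim/quotW=> x; elim/quotW=> y; elim/quotW=> z; rewrite !piE.
by apply: loc_eq1 => /=; ring.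
Qed.

HB.instance Definition _ :=
  GRing.Zmodule_isComPzRing.Build loc loc_mulA loc_mulC loc_mul1 loc_mulD.

Lemma to_loc_zmod : zmod_morphism to_loc.
Proof.
move=> a b; rewrite /to_loc -[X in _ = _ + X]loc_pi_opp -[RHS]loc_pi_add.
by apply: loc_eq1 => /=; ring.
Qed.

Lemma to_loc_monoid : monoid_morphism to_loc.
Proof.
by split=> // a b; rewrite /to_loc -[RHS]loc_pi_mul; apply: loc_eq1 => /=; ring.
Qed.

HB.instance Definition _ := GRing.isZmodMorphism.Build R loc to_loc to_loc_zmod.
HB.instance Definition _ :=
  GRing.isMonoidMorphism.Build R loc to_loc to_loc_monoid.

End Loc.

(* The completion lim_n R/J^n at the Jacobson radical J: a compatible family in
   the product of the R/J^n is given by representatives u n, and two sequences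
   of representatives are identified if they are termwise congruent. *)
Section Completion.
Variable R : comPzRingType.

Definition jpower (n : nat) : set R := power setT (@jacobson R) n.

Lemma jpower_submodule n : submodule setT (jpower n).
Proof.
elim: n => [//|n _]; split=> [|x y Jx Jy|a x _ Jx].
- by move=> E [[]].
- move=> E hE; have [_ ED] := hE.1.
  by apply: ED; [exact: Jx E hE|exact: Jy E hE].
move=> E [[E0 ED] sE]; apply: (Jx [set y | E (a * y)]); split.
  by split=> [|y z Ey Ez] /=; rewrite ?mulr0 ?mulrDr //; apply: ED.
move=> _ [y [z [Jy Jz ->]]]; apply: sE; exists (a * y), z; split=> //.
  by move=> M maxM; have [[_ [_ _ MM]] _ _] := maxM; apply: MM => //; apply: Jy.
by rewrite mulrA.
Qed.

Definition coherent : {pred nat -> R} :=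
  fun u => `[< forall n, jpower n (u n.+1 - u n) >].

Lemma coherent_subring : subring_closed coherent.
Proof.
split=> [|u v /asboolP cu /asboolP cv|u v /asboolP cu /asboolP cv];
  apply/asboolP => n; have [J0 JD JM] := jpower_submodule n; rewrite /=.
- by rewrite subrr.
- have -> : (u - v) n.+1 - (u - v) n =
      (u n.+1 - u n) + (-1) * (v n.+1 - v n).
    by rewrite !fctE; ring.
  exact/JD/JM.
have -> : (u * v) n.+1 - (u * v) n =
    v n.+1 * (u n.+1 - u n) + u n * (v n.+1 - v n).
  by rewrite !fctE; ring.
by apply: JD; apply: JM.
Qed.

Record family := Family { reps :> nat -> R; _ : reps \in coherent }.
HB.instance Definition _ := [isSub for reps].
HB.instance Definition _ := [Choice of family by <:].
HB.instance Definition _ := 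
  GRing.SubChoice_isSubComPzRing.Build (nat -> R) coherent family
    coherent_subring.

Lemma repsN u n : (- u : family) n = - u n.
Proof. exact: (congr1 (@^~ n) (rmorphN (val : family -> _) u)). Qed.

Lemma repsD u v n : (u + v : family) n = u n + v n.
Proof. exact: (congr1 (@^~ n) (rmorphD (val : family -> _) u v)). Qed.

Lemma repsM u v n : (u * v : family) n = u n * v n.
Proof. exact: (congr1 (@^~ n) (rmorphM (val : family -> _) u v)). Qed.

Definition congruent (u v : family) : bool := `[< forall n, jpower n (u n - v n) >].

Lemma congruent_refl : reflexive congruent.
Proof.
by move=> u; apply/asboolP => n; rewrite subrr; have [] := jpower_submodule n.
Qed.

Lemma congruent_sym : symmetric congruent.
Proof.
suff h u v : congruent u v -> congruent v u by move=> u v; apply/idP/idP; exact: h.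
move=> /asboolP uv; apply/asboolP => n; have [_ _ JM] := jpower_submodule n.
by rewrite -opprB -mulN1r; apply: JM.
Qed.

Lemma congruent_trans : transitive congruent.
Proof.
move=> v u w /asboolP uv /asboolP vw; apply/asboolP => n.
have [_ JD _] := jpower_submodule n.
by rewrite -(subrK (v n) (u n)) -addrA; apply: JD.
Qed.

Canonical congruent_equiv :=
  EquivRel congruent congruent_refl congruent_sym congruent_trans.

Definition completion := {eq_quot congruent}.
HB.instance Definition _ : EqQuotient _ congruent completion := EqQuotient.on completion.
HB.instance Definition _ := Choice.on completion.

Lemma completion_eqP (u v : family) : \pi_completion u = \pi_completion v <->
  forall n, jpower n (u n - v n).
Proof.
split=> [/eqmodP/asboolP //|h]; apply/eqmodP; exact/asboolP.
Qed.

Definition completion_zero : completion := \pi_completion 0.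
Definition completion_one : completion := \pi_completion 1.
Definition completion_add : completion -> completion -> completion := lift_op2 completion +%R.
Definition completion_opp : completion -> completion := lift_op1 completion -%R.
Definition completion_mul : completion -> completion -> completion := lift_op2 completion *%R.

Lemma completion_reprP (u : family) n : jpower n (u n - repr (\pi_completion u) n).
Proof. by move: n; apply/completion_eqP; rewrite reprK. Qed.

Lemma completion_pi_opp : {morph \pi : u / - u >-> completion_opp u}.
Proof.
move=> u; unlock completion_opp; apply/completion_eqP => n; have := completion_reprP u n.
move: (repr (\pi_completion u)) => u' e; have [_ _ JM] := jpower_submodule n.
rewrite !repsN.
have -> : - u n - - u' n = -1 * (u n - u' n) by ring.
exact: JM.
Qed.
Canonical completion_pi_opp_morph := PiMorph1 completion_pi_opp.

Lemma completion_pi_add : {morph \pi : u v / u + v >-> completion_add u v}.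
Proof.
move=> u v; unlock completion_add; apply/completion_eqP => n.
have := completion_reprP u n; have := completion_reprP v n.
move: (repr (\pi_completion u)) (repr (\pi_completion v)) => u' v' ev eu.
have [_ JD _] := jpower_submodule n; rewrite !repsD.
by rewrite opprD addrACA; apply: JD.
Qed.
Canonical completion_pi_add_morph := PiMorph2 completion_pi_add.

Lemma completion_pi_mul : {morph \pi : u v / u * v >-> completion_mul u v}.
Proof.
move=> u v; unlock completion_mul; apply/completion_eqP => n.
have := completion_reprP u n; have := completion_reprP v n.
move: (repr (\pi_completion u)) (repr (\pi_completion v)) => u' v' ev eu.
have [_ JD JM] := jpower_submodule n; rewrite !repsM.
have -> : u n * v n - u' n * v' n = v n * (u n - u' n) + u' n * (v n - v' n).
  by ring.
by apply: JD; apply: JM.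
Qed.
Canonical completion_pi_mul_morph := PiMorph2 completion_pi_mul.

Lemma completion_addA : associative completion_add.
Proof.
by elim/quotW=> u; elim/quotW=> v; elim/quotW=> w; rewrite !piE addrA.
Qed.

Lemma completion_addC : commutative completion_add.
Proof. by elim/quotW=> u; elim/quotW=> v; rewrite !piE addrC. Qed.

Lemma completion_add0 : left_id completion_zero completion_add.
Proof. by elim/quotW=> u; rewrite -completion_pi_add add0r. Qed.

Lemma completion_addN : left_inverse completion_zero completion_opp completion_add.
Proof. by elim/quotW=> u; rewrite -completion_pi_opp -completion_pi_add addNr. Qed.

HB.instance Definition _ := GRing.isZmodule.Build completion completion_addA completion_addC completion_add0 completion_addN.

Lemma completion_mulA : associative completion_mul.
Proof.
by elim/quotW=> u; elim/quotW=> v; elim/quotW=> w; rewrite !piE mulrA.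
Qed.

Lemma completion_mulC : commutative completion_mul.
Proof. by elim/quotW=> u; elim/quotW=> v; rewrite !piE mulrC. Qed.

Lemma completion_mul1 : left_id completion_one completion_mul.
Proof. by elim/quotW=> u; rewrite -completion_pi_mul mul1r. Qed.

Lemma completion_mulD : left_distributive completion_mul completion_add.
Proof.
by elim/quotW=> u; elim/quotW=> v; elim/quotW=> w; rewrite !piE mulrDl.
Qed.

HB.instance Definition _ :=
  GRing.Zmodule_isComPzRing.Build completion completion_mulA completion_mulC completion_mul1 completion_mulD.

Lemma cst_coherent (a : R) : cst a \in coherent.
Proof.
by apply/asboolP => n; rewrite /cst subrr; have [] := jpower_submodule n.
Qed.

Definition to_completion (a : R) : completion := \pi_completion (Family (cst_coherent a)).

Lemma to_completion_zmod : zmod_morphism to_completion.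
Proof.
move=> a b; rewrite /to_completion -[X in _ = _ + X]completion_pi_opp -[RHS]completion_pi_add.
by congr \pi; apply: val_inj; apply/funext => n /=; rewrite fctE.
Qed.

Lemma to_completion_monoid : monoid_morphism to_completion.
Proof.
split=> [|a b]; rewrite /to_completion -?[RHS]completion_pi_mul.
  by congr \pi; apply: val_inj.
by congr \pi; apply: val_inj; apply/funext => n /=; rewrite fctE.
Qed.

HB.instance Definition _ :=
  GRing.isZmodMorphism.Build R completion to_completion to_completion_zmod.
HB.instance Definition _ :=
  GRing.isMonoidMorphism.Build R completion to_completion to_completion_monoid.

End Completion.

Section FractionalIdeals.
Variable R : comPzRingType.

Definition total_frac : comPzRingType := loc (@regular R).

Definition to_frac : {rmorphism R -> total_frac} := to_loc (@regular R).

(* R as a subring of its total ring of fractions. *)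
Definition ring_in_frac : set total_frac := range to_frac.

Definition fractional_ideal (E : set total_frac) : Prop :=
  submodule ring_in_frac E /\
  exists2 r, regular r & forall x, E x -> ring_in_frac (to_frac r * x).

Definition regular_fractional_ideal (E : set total_frac) : Prop :=
  fractional_ideal E /\ exists x, E x /\ regular x.

Definition valuation_rings : set (set total_frac) :=
  [set V : set total_frac | [/\ subring_closed [in V], ring_in_frac `<=` V, V <> setT
    & forall x y, ~ V x -> ~ V y -> ~ V (x * y)]].

Section Valuation.
Variable V : set total_frac.

(* The regular maximal ideal of V, meaningful only if it is unique. *)
Definition max_of : set total_frac :=
  xget set0 [set M | maximal_ideal_of V M /\ exists x, M x /\ regular x].

(* The powers of max_of with exponents in int; the inverse of an invertible
   V-submodule I is the set of all x such that x * I is contained in V. *)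
Definition max_power (k : int) : set total_frac :=
  match k with
  | Posz n => power V max_of n
  | Negz n => [set x | forall y, power V max_of n.+1 y -> V (x * y)]
  end.

(* None stands for infinity. *)
Definition nu (x : total_frac) : option int :=
  if `[< forall k, max_power k x >] then None
  else Some (xget 0 [set k | max_power k x /\
                             forall l, max_power l x -> l <= k]).

(* The contraction to R of the regular maximal ideal of V. *)
Definition center : set R := to_frac @^-1` max_of.

End Valuation.

Definition Gamma (E : set total_frac) : set (valuation_rings -> int) :=
  [set alpha | exists x,
    [/\ E x, regular x & forall V, nu (sval V) x = Some (alpha V)]].

End FractionalIdeals.

Arguments valuation_rings R : clear implicits.

(* The B-submodule E B of the total ring of fractions of B that is generated
   by the image of E, for a ring morphism f : A -> B.  The image of a fraction
   a / s is f a / f s; this needs f s to be regular, which holds for all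
   regular s if f is flat. *)
Definition extend (A B : comPzRingType) (f : {rmorphism A -> B})
    (E : set (total_frac A)) : set (total_frac B) :=
  prod_ideal (@ring_in_frac B)
    [set y | exists a s, [/\ regular s, regular (f s),
       exists2 x, E x & x * to_frac A s = to_frac A a
       & y * to_frac B (f s) = to_frac B (f a)]].

Definition local_at (R : comPzRingType) (m : set R) : comPzRingType :=
  loc (~` m).

Definition to_local (R : comPzRingType) (m : set R) :
  {rmorphism R -> local_at m} := to_loc (~` m).

Definition hat (R : comPzRingType) : comPzRingType := completion R.

Definition to_hat (R : comPzRingType) : {rmorphism R -> hat R} :=
  @to_completion R.

(* The set of the elements of R / m. *)
Definition residues (R : comPzRingType) (m : set R) : set (set R) :=
  range (fun x => [set y | m (y - x)]).

Record semilocal_cohen_macaulay_dim1 (R : comPzRingType) : Prop := {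
  scm_noetherian : noetherian R;
  scm_dim : krull_dim R 1;
  scm_semilocal : finite_set (Max R);
  scm_depth : forall m, Max R m -> local_depth (local_at m) 1
}.

Definition analytically_reduced (R : comPzRingType) : Prop := reduced (hat R).

Definition large_residue_fields (R : comPzRingType) : Prop :=
  forall m, Max R m -> valuation_rings (local_at m) #<= residues m.

(* V corresponds to W under the chain of identifications
     V |-> V_m |-> V_m (R_m)^ = W_n <-| W,
   where m and n are the centers of V in R and of W in the completion R^ of R,
   and (R_m)^ is identified with the localization (R^)_n of R^ by an
   isomorphism of R-algebras theta (there is at most one). *)
Definition identified (R : comPzRingType)
    (V : set (total_frac R)) (W : set (total_frac (hat R))) : Prop :=
  let m := center V in
  let n := center W in
  exists theta : {rmorphism hat (local_at m) -> local_at n},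
    [/\ bijective theta,
        forall a, theta (to_hat _ (to_local m a)) = to_local n (to_hat R a)
      & extend theta (extend (to_hat _) (extend (to_local m) V)) =
        extend (to_local n) W].

(* Main.v *)
(* A regular element t of the Jacobson radical J satisfies J^K <= tR for some K,
   and every regular element of R divides a power of t; the same holds for the
   image of t in the completion R^.  Hence the total rings of fractions are
   Q = R[1/t] and Q^ = R^[1/t], and since R^ = R + tR^ and R meets tR^ in tR, the
   map E |-> E R^ is a bijection, compatible with products, between the
   R-submodules of Q and the R^-submodules of Q^ containing a power of t.  It
   matches valuation rings, their regular maximal ideals and the powers of
   these, so that it preserves values.  Finally an element y of E R^ is
   x + t^k w with x in E and k large, and then x is y times a unit of R^.
   The valuation rings of Q have a unique regular maximal ideal because Q is von
   Neumann regular. *)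
Require Import Defs.
From HB Require Import structures.
From mathcomp Require Import all_boot all_order all_algebra.
From mathcomp Require Import generic_quotient ring.
From mathcomp Require Import boolp classical_sets functions cardinality.

Set Implicit Arguments.
Unset Strict Implicit.
Unset Printing Implicit Defensive.

Import Order.TTheory GRing.Theory Num.Theory.
Local Open Scope classical_set_scope.
Local Open Scope ring_scope.
Local Open Scope quotient_scope.

(** What the proof uses about R^ comes from R^/tR^ = R/tR together with completeness. Every prime of
    R above the regular element t is maximal, which gives the descending chain condition for the
    ideals containing t. This condition and successive approximation yield that regular elements of
    R^ divide powers of t. Reducedness enters through elements a + y, where y is annihilated by a
    and a + y is regular: they make Q von Neumann regular, and they lift regular elements of a
    localization R_m to R. On the side of R^ the regular maximal ideal of an extended valuation ring
    is unique because it contracts to the one of V. Since R need not be local, the identification of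
    V with its extension W requires an isomorphism from the completion of R_m to (R^)_n, with m and
    n the centers of V and W. An idempotent of R/tR that selects m lifts to an idempotent of R^
    cutting out the factor (R^)_n, and the isomorphism is read off from common t-adic approximations
    by elements of R. *)

(** Closure under subtraction reduces single-valuedness of [G] to the fibre over 0. Both the map
    between total rings of fractions and [theta] are built from such a graph, so that no choice of
    representatives has to be compared. *)
Lemma rmorph_of_rel (A B : comPzRingType) (G : A -> B -> Prop) :
  (forall x, exists y, G x y) -> G 1 1 ->
  (forall x y x' y', G x y -> G x' y' -> G (x - x') (y - y')) ->
  (forall x y x' y', G x y -> G x' y' -> G (x * x') (y * y')) ->
  (forall y, G 0 y -> y = 0) ->
  exists h : {rmorphism A -> B}, forall x y, G x y <-> y = h x.
Proof.
move=> /choice[h Gh] G1 GB GM G0.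
have hE x y : G x y -> y = h x.
  move=> Gxy; apply/eqP; rewrite -subr_eq0; apply/eqP/G0.
  by rewrite -(subrr x); apply: GB.
have h_zmod : zmod_morphism h by move=> x y; apply/esym/hE/GB.
have h_monoid : monoid_morphism h.
  by split=> [|x y]; apply/esym/hE => //; apply: GM.
pose hM := GRing.isMonoidMorphism.Build A B h h_monoid.
pose hZ := GRing.isZmodMorphism.Build A B h h_zmod.
pose hR : {rmorphism A -> B} := HB.pack h hZ hM.
by exists hR => x y; split=> [/hE//|->]; exact: Gh.
Qed.

(** * Submodules, their products and powers *)

Section Submodules.
Variable T : comPzRingType.
Implicit Types (A B E F I J : set T).

Lemma submoduleB A E x y : A (- 1) -> submodule A E -> E x -> E y -> E (x - y).
Proof. by move=> A1 [_ ED EM] Ex Ey; apply: ED => //; rewrite -mulN1r; exact: EM. Qed.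

Lemma submoduleW A B E : A `<=` B -> submodule B E -> submodule A E.
Proof. by move=> AB [E0 ED EM]; split=> // a x /AB; exact: EM. Qed.

Lemma submodule_sum A E (I : Type) (r : seq I) (P : pred I) (F : I -> T) :
  submodule A E -> (forall i, P i -> E (F i)) -> E (\sum_(i <- r | P i) F i).
Proof. by move=> [E0 ED _] EF; elim/big_ind: _. Qed.

Lemma add_span_sub (X : set T) : X `<=` add_span X.
Proof. by move=> x Xx E [_]; apply. Qed.

Lemma add_span0 (X : set T) : add_span X 0.
Proof. by move=> E [[]]. Qed.

Lemma add_spanD (X : set T) x y : add_span X x -> add_span X y -> add_span X (x + y).
Proof. by move=> Xx Xy E hE; case: (hE) => -[_ ED] _; apply: ED; [exact: Xx|exact: Xy]. Qed.

Lemma add_span_ind (X E : set T) : E 0 -> (forall x y, E x -> E y -> E (x + y)) ->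
  X `<=` E -> add_span X `<=` E.
Proof. by move=> E0 ED XE x; apply. Qed.

Lemma prod_ideal_sub I J x y : I x -> J y -> prod_ideal I J (x * y).
Proof. by move=> Ix Jy; apply: add_span_sub; exists x, y. Qed.

Lemma prod_ideal_ind I J E : E 0 -> (forall x y, E x -> E y -> E (x + y)) ->
  (forall x y, I x -> J y -> E (x * y)) -> prod_ideal I J `<=` E.
Proof.
by move=> E0 ED EIJ; apply: add_span_ind => // _ [x [y [Ix Jy ->]]]; exact: EIJ.
Qed.

Lemma prod_ideal_submodule A I J : submodule A J -> submodule A (prod_ideal I J).
Proof.
move=> [_ _ JM]; split=> [|x y|a]; [exact: add_span0|exact: add_spanD|].
move=> x Aa; apply: (@prod_ideal_ind I J [set x | prod_ideal I J (a * x)]).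
- by rewrite /= mulr0; exact: add_span0.
- by move=> y z; rewrite /= mulrDr; exact: add_spanD.
- by move=> y z Iy Jz; rewrite /= mulrCA; apply: prod_ideal_sub => //; exact: JM.
Qed.

Lemma prod_ideal_submodule_l A I J :
  submodule A I -> submodule A (prod_ideal I J).
Proof.
move=> [_ _ IM]; split=> [|x y|a]; [exact: add_span0|exact: add_spanD|].
move=> x Aa; apply: (@prod_ideal_ind I J [set x | prod_ideal I J (a * x)]).
- by rewrite /= mulr0; exact: add_span0.
- by move=> y z; rewrite /= mulrDr; exact: add_spanD.
- by move=> y z Iy Jz; rewrite /= mulrA; apply: prod_ideal_sub => //; exact: IM.
Qed.

Lemma power_submodule A I n : submodule A A -> submodule A (power A I n).
Proof. by move=> AA; elim: n => // n IH; exact: prod_ideal_submodule. Qed.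

Lemma power_exp A I x n : A 1 -> I x -> power A I n (x ^+ n).
Proof. by move=> A1 Ix; elim: n => // n IH; rewrite exprS; exact: prod_ideal_sub. Qed.

End Submodules.

(** * Ideals, regular elements and powers of the Jacobson radical *)

Section Ideals.
Variable R : comPzRingType.
Implicit Types (I J M P : set R).

Lemma idealE I : ideal I <-> submodule setT I.
Proof. by split=> [[]|]. Qed.

Lemma idealB I x y : ideal I -> I x -> I y -> I (x - y).
Proof. by move=> /idealE; exact: submoduleB. Qed.

Lemma idealD I x y : ideal I -> I x -> I y -> I (x + y).
Proof. by move=> [_ [_ ID _]]; exact: ID. Qed.

Lemma idealMr I a x : ideal I -> I x -> I (a * x).
Proof. by move=> [_ [_ _ IM]]; exact: IM. Qed.

Lemma idealMl I a x : ideal I -> I x -> I (x * a).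
Proof. by rewrite mulrC; exact: idealMr. Qed.

Lemma ideal0 I : ideal I -> I 0.
Proof. by move=> [_ []]. Qed.

Lemma ideal1 I : ideal I -> I 1 -> I = setT.
Proof. by move=> iI I1; apply/seteqP; split=> // x _; rewrite -(mulr1 x); exact: idealMr. Qed.

Definition ideal_add I (a : R) : set R := [set x | exists2 y, I y & exists b, x = y + b * a].

Lemma ideal_add_ideal I a : ideal I -> ideal (ideal_add I a).
Proof.
move=> iI; apply/idealE; split.
- by exists 0; [exact: ideal0|exists 0; ring].
- move=> _ _ [x Ix [b ->]] [y Iy [c ->]]; exists (x + y); first exact: idealD.
  by exists (b + c); ring.
- move=> c _ _ [x Ix [b ->]]; exists (c * x); first exact: idealMr.
  by exists (c * b); ring.
Qed.

Lemma ideal_add_sub I a : I `<=` ideal_add I a.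
Proof. by move=> x Ix; exists x => //; exists 0; ring. Qed.

Lemma ideal_add_mem I a : ideal I -> ideal_add I a a.
Proof. by move=> iI; exists 0; [exact: ideal0|exists 1; ring]. Qed.

Definition principal (a : R) : set R := [set x | exists b, x = b * a].

Lemma principal_ideal a : ideal (principal a).
Proof.
apply/idealE; split; first by exists 0; ring.
- by move=> _ _ [b ->] [c ->]; exists (b + c); ring.
- by move=> d _ _ [b ->]; exists (d * b); ring.
Qed.

Definition colon I (a : R) : set R := [set x | I (a * x)].

Lemma colon_ideal I a : ideal I -> ideal (colon I a).
Proof.
move=> iI; apply/idealE; split=> [|x y Ix Iy|b x _ Ix]; rewrite /colon /=.
- by rewrite mulr0; exact: ideal0.
- by rewrite mulrDr; exact: idealD.
- by rewrite mulrCA; exact: idealMr.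
Qed.

Lemma ideal_gen_ideal (s : seq R) : ideal (ideal_gen s).
Proof.
apply/idealE; split; [exact: add_span0|by move=> *; exact: add_spanD|].
move=> a x _; apply: (@prod_ideal_ind _ setT _ [set x | ideal_gen s (a * x)]).
- by rewrite /= mulr0; exact: add_span0.
- by move=> y z; rewrite /= mulrDr; exact: add_spanD.
- by move=> y z _ sz; rewrite /= mulrA; exact: prod_ideal_sub.
Qed.

Lemma ideal_gen_mem (s : seq R) x : x \in s -> ideal_gen s x.
Proof. by move=> sx; rewrite -(mul1r x); exact: prod_ideal_sub. Qed.

Lemma ideal_gen_sub (s : seq R) I : ideal I -> (forall x, x \in s -> I x) -> ideal_gen s `<=` I.
Proof.
move=> iI sI; apply: prod_ideal_ind; first exact: ideal0.
  by move=> x y; exact: idealD.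
by move=> a x _ /sI; exact: idealMr.
Qed.

Lemma ideal_genP (s : seq R) x : ideal_gen s x ->
  exists c : 'I_(size s) -> R, x = \sum_i c i * s`_i.
Proof.
move: x; apply: prod_ideal_ind.
- by exists (fun=> 0); rewrite big1 // => i _; rewrite mul0r.
- move=> _ _ [c ->] [d ->]; exists (fun i => c i + d i).
  by rewrite -big_split; apply: eq_bigr => i _; rewrite mulrDl.
- move=> a x _ sx; have hi : (index x s < size s)%N by rewrite index_mem.
  exists (fun i => if i == Ordinal hi then a else 0).
  rewrite (bigD1 (Ordinal hi)) //= eqxx nth_index // big1 ?addr0 // => i /negPf ->.
  by rewrite mul0r.
Qed.

Lemma ideal_gen_nil x : ideal_gen [::] x -> x = 0 :> R.
Proof. by case/ideal_genP => c ->; rewrite big_ord0. Qed.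

Lemma regular1 : regular (1 : R).
Proof. by move=> y; rewrite mul1r. Qed.

Lemma regularM (a b : R) : regular a -> regular b -> regular (a * b).
Proof. by move=> ra rb y; rewrite -mulrA => /ra/rb. Qed.

Lemma regularX (a : R) n : regular a -> regular (a ^+ n).
Proof. by move=> ra; elim: n => [|n IH]; [exact: regular1|rewrite exprS; exact: regularM]. Qed.

Lemma regular_inj (a x y : R) : regular a -> a * x = a * y -> x = y.
Proof.
move=> ra e; apply/eqP; rewrite -subr_eq0; apply/eqP/ra.
by rewrite mulrBr e subrr.
Qed.

Lemma regular_unit (a b : R) : a * b = 1 -> regular a.
Proof. by move=> ab y ay; rewrite -(mul1r y) -ab mulrAC ay mul0r. Qed.

Lemma regular_dvd (a b c : R) : regular c -> c = a * b -> regular a.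
Proof. by move=> rc e y ay; apply: rc; rewrite e mulrAC ay mul0r. Qed.

Lemma unitX (a b : R) n : a * b = 1 -> a ^+ n * b ^+ n = 1.
Proof. by move=> ab; rewrite -exprMn ab expr1n. Qed.

Lemma maximal_ideal M : Max R M -> ideal M.
Proof. by case. Qed.

Lemma maximal_not1 M : Max R M -> ~ M 1.
Proof. by move=> [iM MT _] M1; apply: MT; exact: ideal1. Qed.

Lemma maximal_comax M a : Max R M -> ~ M a -> exists b, M (1 - b * a).
Proof.
move=> [iM _ Mmax] Ma; have := Mmax _ (ideal_add_ideal a iM) (@ideal_add_sub M a).
case=> [e|e].
  by case: Ma; rewrite -e; exact: ideal_add_mem.
have : ideal_add M a 1 by rewrite e.
by case=> y My [b e1]; exists b; rewrite e1 addrK.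
Qed.

Lemma maximal_prime M : Max R M -> prime_ideal M.
Proof.
move=> mM; have iM := maximal_ideal mM; split=> // [|x y Mxy].
  exact: maximal_not1.
have [Mx|nMx] := pselect (M x); [by left|right].
have [b Mb] := maximal_comax mM nMx.
have -> : y = y * (1 - b * x) + b * (x * y) by ring.
by apply: idealD => //; exact: idealMr.
Qed.

Lemma maximal_eq M I : Max R M -> ideal I -> ~ I 1 -> M `<=` I -> I = M.
Proof. by move=> [_ _ Mmax] iI I1 /(Mmax _ iI)[//|e]; case: I1; rewrite e. Qed.

Lemma prime_not_mul P x y : prime_ideal P -> ~ P x -> ~ P y -> ~ P (x * y).
Proof. by move=> [_ _ Pm] nx ny /Pm[]. Qed.

Lemma prime_exp P x n : prime_ideal P -> P (x ^+ n) -> P x.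
Proof.
move=> pP; case: (pP) => _ P1 Pm; elim: n => [//|n IH].
by rewrite exprS => /Pm[].
Qed.

Lemma jacobson_ideal : ideal (@jacobson R).
Proof.
apply/idealE; split=> [M|x y Jx Jy M|a x _ Jx M] /[dup] mM /maximal_ideal iM.
- exact: ideal0.
- by apply: idealD => //; [exact: Jx|exact: Jy].
- by apply: idealMr => //; exact: Jx.
Qed.

Lemma jpower_ideal n : ideal (@jpower R n).
Proof. by apply/idealE; exact: jpower_submodule. Qed.

Lemma jpower0 n : @jpower R n 0.
Proof. exact: ideal0 (jpower_ideal n). Qed.

Lemma jpower_le m n : (m <= n)%N -> @jpower R n `<=` jpower m.
Proof.
move=> /subnK <-; elim: (n - m)%N => // k IH.
have im := jpower_ideal m.
apply: prod_ideal_ind; [exact: ideal0|by move=> *; exact: idealD|].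
by move=> x y _ /IH; exact: idealMr.
Qed.

Lemma jpower_exp (a : R) n : jacobson a -> jpower n (a ^+ n).
Proof. by move=> Ja; exact: power_exp. Qed.

Lemma jpower_dvd (t : R) n x : jacobson t -> principal (t ^+ n) x -> jpower n x.
Proof.
move=> Jt [b ->]; apply: idealMr; first exact: jpower_ideal.
exact: jpower_exp.
Qed.

(** Induction on [m] with [I] general: a factor [x] of the Jacobson radical is split off and
    absorbed by passing from [I] to [colon I x]. *)
Lemma jpower_add_sub m n I : ideal I ->
  (forall x y, jpower m x -> jpower n y -> I (x * y)) -> @jpower R (m + n) `<=` I.
Proof.
elim: m I => [|m IH] I iI mnI; first by move=> x Jx; rewrite -(mul1r x); exact: mnI.
rewrite addSn; apply: prod_ideal_ind; [exact: ideal0|by move=> *; exact: idealD|].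
move=> x y Jx; apply: (IH (colon I x)); first exact: colon_ideal.
by move=> a b Ja Jb; rewrite /colon /= mulrA; apply: mnI => //; exact: prod_ideal_sub.
Qed.

Lemma jpower_principal (t : R) K n : jpower K `<=` principal t ->
  jpower (K * n) `<=` principal (t ^+ n).
Proof.
move=> JK; elim: n => [|n IH]; first by move=> x _; exists x; rewrite mulr1.
rewrite mulnS; apply: jpower_add_sub; first exact: principal_ideal.
by move=> _ _ /JK[b ->] /IH[c ->]; exists (b * c); rewrite exprS; ring.
Qed.

End Ideals.

(** * Noetherian rings *)

Section Noetherian.
Variable R : comPzRingType.
Hypothesis noethR : noetherian R.
Implicit Types (I J M P N : set R).

Lemma noetherian_acc (I : nat -> set R) : (forall n, ideal (I n)) ->
  (forall n, I n `<=` I n.+1) -> exists n, forall m, (n <= m)%N -> I m = I n.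
Proof.
move=> iI sI.
have mono m n : (m <= n)%N -> I m `<=` I n.
  by move=> /subnK <-; elim: (n - m)%N => // k IH; exact: subset_trans IH (sI _).
pose U : set R := [set x | exists n, I n x].
have iU : ideal U.
  apply/idealE; split; first by exists 0%N; exact: ideal0.
  - move=> x y [m Ix] [n Iy]; exists (maxn m n); apply: idealD => //.
      exact: (mono m) (leq_maxl _ _) _ Ix.
    exact: (mono n) (leq_maxr _ _) _ Iy.
  - by move=> a x _ [n Ix]; exists n; exact: idealMr.
have [s Us] := noethR iU.
have [n sn] : exists n, forall x, x \in s -> I n x.
  have : forall x, x \in s -> U x by rewrite Us => x; exact: ideal_gen_mem.
  elim: s {Us} => [|a s IH] sU; first by exists 0%N.
  have [|n In] := IH; first by move=> x xs; apply: sU; rewrite inE xs orbT.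
  have [m Im] := sU a (mem_head _ _).
  exists (maxn m n) => x; rewrite inE => /predU1P[->|/In].
    exact: (mono m) (leq_maxl _ _) _ Im.
  exact: (mono n) (leq_maxr _ _) _.
exists n => m nm; apply/seteqP; split; last exact: mono.
move=> x Ix; apply: (ideal_gen_sub (iI n) sn).
by rewrite -Us; exists m.
Qed.

Lemma noetherian_max (F : set (set R)) I0 : F I0 -> (forall I, F I -> ideal I) ->
  exists M, F M /\ forall I, F I -> M `<=` I -> I = M.
Proof.
move=> FI0 Fi; apply: contrapT => nomax.
have /choice[f fP] : forall M, exists I, F M -> [/\ F I, M `<=` I & I <> M].
  move=> M; have [FM|nFM] := pselect (F M); last by exists M.
  apply: contrapT => noI; apply: nomax; exists M; split=> // I FI MI.
  by apply: contrapT => IM; apply: noI; exists I.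
pose g n := iter n f I0.
have Fg n : F (g n) by elim: n => // n /fP[].
have [||n gn] := @noetherian_acc g.
- by move=> n; exact: Fi.
- by move=> n; have [] := fP _ (Fg n).
by have [_ _] := fP _ (Fg n); apply; exact: gn _ (leqnSn n).
Qed.

Lemma ex_prime_avoiding (S : set R) I : ideal I -> S 1 ->
  (forall x y, S x -> S y -> S (x * y)) -> (forall x, I x -> ~ S x) ->
  exists P, [/\ prime_ideal P, I `<=` P & forall x, P x -> ~ S x].
Proof.
move=> iI S1 SM IS.
have [||P [[iP IP PS] Pmax]] := @noetherian_max
    [set P | [/\ ideal P, I `<=` P & forall x, P x -> ~ S x]] I.
- by split.
- by move=> P [].
exists P; split=> //; split=> // [/PS//|x y Pxy].
apply: contrapT => /not_orP[nPx nPy].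
have meet z : ~ P z -> exists2 s, S s & ideal_add P z s.
  move=> nPz; apply: contrapT => noS; apply: nPz.
  have <- : ideal_add P z = P.
    apply: Pmax; last exact: ideal_add_sub.
    split; [exact: ideal_add_ideal|exact: subset_trans IP (@ideal_add_sub _ _ _)|].
    by move=> s zs Ss; apply: noS; exists s.
  exact: ideal_add_mem.
have [s Ss [m Pm [b es]]] := meet _ nPx.
have [s' Ss' [m' Pm' [b' es']]] := meet _ nPy.
apply: (PS (s * s')); last exact: SM.
have -> : s * s' = s' * m + (b * x) * m' + (b * b') * (x * y) by rewrite es es'; ring.
by apply: idealD => //; [apply: idealD => //|]; exact: idealMr.
Qed.

Lemma ex_maximal I : ideal I -> ~ I 1 -> exists2 M, Max R M & I `<=` M.
Proof.
move=> iI I1.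
have [||M [[iM IM M1] Mmax]] := @noetherian_max
    [set M | [/\ ideal M, I `<=` M & ~ M 1]] I.
- by split.
- by move=> M [].
exists M => //; split=> // [e|K iK MK]; first by apply: M1; rewrite e.
have [K1|nK1] := pselect (K 1); first by right; exact: ideal1.
by left; apply: Mmax => //; split=> //; exact: subset_trans MK.
Qed.

Lemma jacobson_unit (a : R) : jacobson a -> exists b, (1 + a) * b = 1.
Proof.
move=> Ja; apply: contrapT => nob.
have [|M mM sM] := @ex_maximal (principal (1 + a)) (principal_ideal _).
  by move=> [b e]; apply: nob; exists b; rewrite mulrC -e.
apply: (maximal_not1 mM).
have -> : 1 = (1 + a) - a by rewrite addrK.
apply: idealB; [exact: maximal_ideal| |exact: Ja].
by apply: sM; exists 1; rewrite mul1r.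
Qed.

Lemma radical_primes I (a : R) : ideal I ->
  (forall P, prime_ideal P -> I `<=` P -> P a) -> exists n, I (a ^+ n).
Proof.
move=> iI aP; apply: contrapT => noa.
have [|||P [pP IP PS]] := @ex_prime_avoiding [set x | exists n, x = a ^+ n] I iI.
- by exists 0%N.
- by move=> _ _ [m ->] [n ->]; exists (m + n)%N; rewrite exprD.
- by move=> x Ix [n e]; apply: noa; exists n; rewrite -e.
by apply: (PS _ (aP P pP IP)); exists 1%N; rewrite expr1.
Qed.

Lemma noetherian_ind (Q : set R -> Prop) :
  (forall I, ideal I -> (forall J, ideal J -> I `<=` J -> J <> I -> Q J) -> Q I) ->
  forall I, ideal I -> Q I.
Proof.
move=> Qind I iI; apply: contrapT => nQI.
have [||M [[iM nQM] Mmax]] := @noetherian_max [set I | ideal I /\ ~ Q I] I.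
- by split.
- by move=> J [].
apply: nQM; apply: Qind => // J iJ MJ JM; apply: contrapT => nQJ.
exact: JM (Mmax J (conj iJ nQJ) MJ).
Qed.

Lemma ideal_add_neq I a : ideal I -> ~ I a -> ideal_add I a <> I.
Proof. by move=> iI nIa e; apply: nIa; rewrite -e; exact: ideal_add_mem. Qed.

Lemma colon_sub I a : ideal I -> I `<=` colon I a.
Proof. by move=> iI x Ix; exact: idealMr. Qed.

(** Noetherian induction on [I]. If some [a] in the radical has a^(n+1) in I but a^n outside, then I
    + (a^n) and I : a^n are both strictly larger than I, and the product of the powers of the
    radical lying in them lies in I. *)
Lemma jpower_radical I : ideal I -> (forall a, jacobson a -> exists n, I (a ^+ n)) ->
  exists K, @jpower R K `<=` I.
Proof.
move=> iI; elim/noetherian_ind: I / iI => I iI IH nilI.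
have [JI|] := pselect (@jacobson R `<=` I).
  exists 1%N; apply: prod_ideal_ind; [exact: ideal0|by move=> *; exact: idealD|].
  by move=> x y /JI Ix _; exact: idealMl.
move=> /existsNP[a /not_implyP[Ja nIa]].
have [n [In nIn]] : exists n, I (a ^+ n.+1) /\ ~ I (a ^+ n).
  have [m] := nilI a Ja; elim: m => [|m IHm] Im.
    by case: nIa; rewrite -(mulr1 a); exact: idealMr.
  by have [/IHm//|nIm] := pselect (I (a ^+ m)); exists m.
have up J : I `<=` J -> forall b, jacobson b -> exists n, J (b ^+ n).
  by move=> IJ b /nilI[m /IJ ?]; exists m.
have sub1 := @ideal_add_sub _ I (a ^+ n).
have sub2 := @colon_sub I (a ^+ n) iI.
have [||K1 K1P] := IH _ (ideal_add_ideal (a ^+ n) iI) sub1; [exact: ideal_add_neq|exact: up|].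
have [||K2 K2P] := IH _ (colon_ideal (a ^+ n) iI) sub2; [|exact: up|].
  by move=> e; apply: nIa; rewrite -e /colon /= -exprSr.
exists (K1 + K2)%N; apply: jpower_add_sub => // _ y /K1P[x Ix [b ->]] /K2P Iy.
rewrite mulrDl; apply: idealD => //; first exact: idealMl.
by rewrite -mulrA; exact: idealMr.
Qed.

(** Noetherian induction on [I] takes the place of length. A prime [I] is maximal, so the chain has
    at most two values. Otherwise a b is in I with a and b outside; the chains D + (a) and D : a
    both stabilise by induction, and together they determine D, since x = y + c a with y in D forces
    c into D : a. *)
Lemma artinian_above I (D : nat -> set R) : ideal I ->
  (forall P, prime_ideal P -> I `<=` P -> Max R P) ->
  (forall n, ideal (D n)) -> (forall n, D n.+1 `<=` D n) -> (forall n, I `<=` D n) ->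
  exists n, forall m, (n <= m)%N -> D m = D n.
Proof.
move=> iI; move: D; elim/noetherian_ind: I / iI => I iI IH D primeI iD sD ID.
have mono m n : (m <= n)%N -> D n `<=` D m.
  by move=> /subnK <-; elim: (n - m)%N => // k IHk; exact: subset_trans (sD _) IHk.
have [I1|nI1] := pselect (I 1).
  by exists 0%N => m _; rewrite (ideal1 (iD m) (ID m _ I1)) (ideal1 (iD _) (ID _ _ I1)).
have [pI|] := pselect (forall x y, I (x * y) -> I x \/ I y).
  have [_ _ Imax] := primeI I (And3 iI nI1 pI) (@subset_refl _ I).
  have [[n Dn]|allT] := pselect (exists n, D n = I).
    exists n => m nm; apply/seteqP; split; first exact: mono.
    by rewrite Dn; exact: ID.
  exists 0%N => m _; have DT k : D k = setT.
    by have [e|//] := Imax _ (iD k) (ID k); case: allT; exists k.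
  by rewrite !DT.
move=> /existsNP[a /existsNP[b /not_implyP[Iab /not_orP[nIa nIb]]]].
have [|||||n1 n1P] := IH _ (ideal_add_ideal a iI) (@ideal_add_sub _ I a) _
    (fun n => ideal_add (D n) a) _ _ _ _.
- exact: ideal_add_neq.
- by move=> P pP IP; apply: primeI => //; exact: subset_trans (@ideal_add_sub _ I a) IP.
- by move=> n; exact: ideal_add_ideal.
- by move=> n _ [x Dx [c ->]]; exists x; [exact: sD|exists c].
- by move=> n _ [x Ix [c ->]]; exists x; [exact: ID|exists c].
have [|||||n2 n2P] := IH _ (colon_ideal a iI) (@colon_sub I a iI) _
    (fun n => colon (D n) a) _ _ _ _.
- by move=> e; apply: nIb; rewrite -e.
- by move=> P pP IP; apply: primeI => //; exact: subset_trans (@colon_sub I a iI) IP.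
- by move=> n; exact: colon_ideal.
- by move=> n x; exact: sD.
- by move=> n x; exact: ID.
exists (maxn n1 n2) => m nm; apply/seteqP; split; first exact: mono.
move=> x Dx; have [le1 le2] : (n1 <= m)%N /\ (n2 <= m)%N.
  by move: nm; rewrite geq_max => /andP[].
have [y Dy [c e]] : ideal_add (D m) a x.
  rewrite n1P // -(n1P (maxn n1 n2)) ?leq_maxl //; exact: ideal_add_sub.
have : colon (D (maxn n1 n2)) a c.
  have -> : colon (D (maxn n1 n2)) a c = D (maxn n1 n2) (x - y).
    by rewrite e /colon /=; congr (D _ _); ring.
  by apply: idealB => //; exact: mono Dy.
rewrite n2P ?leq_maxr // -(n2P m) // => Dc.
by rewrite e; apply: idealD => //; rewrite mulrC.
Qed.

(** Take [N] maximal among the ideals avoiding a nonzero [z]. If some j z were outside N, then z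
    would be congruent to b j z modulo N, and 1 - b j is a unit; so J z lies in N. Once every
    element of J has a power in N, some J^K lies in N, although z is in J^K. *)
Lemma krull_intersection (z : R) : (forall n, jpower n z) -> z = 0.
Proof.
move=> Jz; apply: contrapT => z0.
have [||N [[iN Nz] Nmax]] := @noetherian_max [set I | ideal I /\ ~ I z] [set 0].
- split=> //; apply/idealE; split=> // [_ _ -> ->|a _ _ ->]; by rewrite ?addr0 ?mulr0.
- by move=> I [].
have grow I : ideal I -> N `<=` I -> I <> N -> I z.
  move=> iI NI IN; apply: contrapT => nIz.
  exact: IN (Nmax I (conj iI nIz) NI).
have JN j : jacobson j -> N (j * z).
  move=> Jj; apply: contrapT => nN.
  have [y Ny [b e]] := grow _ (ideal_add_ideal (j * z) iN) (@ideal_add_sub _ N _)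
    (ideal_add_neq iN nN).
  have [|u eu] := @jacobson_unit (- (b * j)).
    by rewrite -mulN1r; apply: idealMr (jacobson_ideal R) _; exact: idealMr (jacobson_ideal R) _.
  apply: Nz; have -> : z = u * y.
    transitivity (((1 + - (b * j)) * u) * z); first by rewrite eu mul1r.
    transitivity (u * (z - b * (j * z))); first by ring.
    by congr (u * _); rewrite {1}e addrK.
  exact: idealMr.
have [|K JK] := @jpower_radical N iN; last by apply: Nz; apply: JK.
move=> a Ja.
(* At the index where N : a^n stabilises, a^n itself is in N: otherwise z = y + w a^n with y in N,
   and a z in N gives w in N : a^(n+1) = N : a^n, hence z in N. *)
have [||n aP] := @noetherian_acc (fun n => colon N (a ^+ n)).
- by move=> n; exact: colon_ideal.
- by move=> n x; rewrite /colon /= exprS -mulrA; exact: idealMr.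
exists n; apply: contrapT => nN.
have [y Ny [w e]] := grow _ (ideal_add_ideal (a ^+ n) iN) (@ideal_add_sub _ N _)
  (ideal_add_neq iN nN).
have : colon N (a ^+ n.+1) w.
  have -> : colon N (a ^+ n.+1) w = N (a * z - a * y).
    by rewrite e /colon /= exprS; congr N; ring.
  by apply: idealB => //; [exact: JN|exact: idealMr].
rewrite aP // => Nw; apply: Nz; rewrite e; apply: idealD => //.
by rewrite mulrC.
Qed.

End Noetherian.

(** * Localization *)

Section Localization.
Variables (R : comPzRingType) (S : set R).

Lemma loc_denomE : S 1 -> (forall x y, S x -> S y -> S (x * y)) -> loc_denom S = S.
Proof.
move=> S1 SM; apply/seteqP; split=> [x|x Sx M [_]]; last exact.
by apply; split.
Qed.

Lemma locP (x : loc S) : exists a s,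
  loc_denom S s /\ x * to_loc S s = to_loc S a.
Proof.
elim/quotW: x => x; exists x.1, x.2; split; first exact: ratio_denomP.
rewrite /to_loc -[LHS](loc_pi_mul x (ratio_of S x.2)).
by apply: loc_eq1 => /=; ring.
Qed.

Lemma to_loc_unit s : loc_denom S s -> exists v, to_loc S s * v = 1.
Proof.
move=> ds; exists (\pi_(loc S) (ratio_mk 1 ds)).
rewrite /to_loc -[LHS](loc_pi_mul (ratio_of S s) (ratio_mk 1 ds)).
by apply: loc_eq1 => /=; ring.
Qed.

Lemma to_loc_eq0 a : to_loc S a = 0 <-> exists2 u, loc_denom S u & u * a = 0.
Proof.
split=> [/loc_eqP[u du /=]|[u du ua]].
  by rewrite !mulr1 mulr0 => ua; exists u.
by apply/loc_eqP; exists u => //=; rewrite !mulr1 mulr0.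
Qed.

End Localization.

Section TotalFractions.
Variable R : comPzRingType.

Lemma regular_denomE : loc_denom (@regular R) = @regular R.
Proof. by apply: loc_denomE; [exact: regular1|exact: regularM]. Qed.

Lemma fracP (x : total_frac R) : exists a s, regular s /\ x * to_frac R s = to_frac R a.
Proof. by have [a [s []]] := locP x; rewrite regular_denomE; exists a, s. Qed.

Lemma to_frac_unit s : regular s -> exists v, to_frac R s * v = 1.
Proof. by rewrite -{1}regular_denomE => /to_loc_unit. Qed.

Lemma to_frac_inj : injective (to_frac R).
Proof.
apply: raddf_inj => a /to_loc_eq0[u]; rewrite regular_denomE => ru; exact: ru.
Qed.

Lemma to_frac_regular s : regular s -> regular (to_frac R s).
Proof. by case/to_frac_unit => v; exact: regular_unit. Qed.

Lemma frac_unit (x : total_frac R) : regular x -> exists y, x * y = 1.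
Proof.
move=> rx; have [a [s [rs e]]] := fracP x.
have ra : regular a.
  move=> b ab; apply: rs; apply: to_frac_inj; apply: rx.
  by rewrite rmorphM mulrA e -rmorphM ab rmorph0.
have [v va] := to_frac_unit ra; exists (to_frac R s * v).
by rewrite mulrA e.
Qed.

Lemma to_frac_ring a : ring_in_frac (to_frac R a).
Proof. by exists a. Qed.

Lemma ring_in_frac_submodule : submodule (@ring_in_frac R) (@ring_in_frac R).
Proof.
split; first by exists 0; rewrite ?rmorph0.
- by move=> _ _ [a _ <-] [b _ <-]; exists (a + b); rewrite ?rmorphD.
- by move=> _ _ [a _ <-] [b _ <-]; exists (a * b); rewrite ?rmorphM.
Qed.

End TotalFractions.

Section LocalAt.
Variables (R : comPzRingType) (m : set R).
Hypothesis pm : prime_ideal m.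

Lemma local_denomE : loc_denom (~` m) = ~` m.
Proof. by apply: loc_denomE => [|x y]; [case: pm|exact: prime_not_mul]. Qed.

Lemma localP (x : local_at m) : exists a s, ~ m s /\ x * to_local m s = to_local m a.
Proof. by have [a [s []]] := locP x; rewrite local_denomE; exists a, s. Qed.

Lemma to_local_unit s : ~ m s -> exists v, to_local m s * v = 1.
Proof. by move=> ms; apply: to_loc_unit; rewrite local_denomE. Qed.

Lemma to_local_eq0 a : to_local m a = 0 <-> exists2 u, ~ m u & u * a = 0.
Proof. by rewrite -[X in exists2 u, X u & _]/(~` m) -local_denomE; exact: to_loc_eq0. Qed.

Lemma to_local_regular s : regular s -> regular (to_local m s).
Proof.
move=> rs x; have [a [u [mu e]]] := localP x => sx0.
have [v mv] : exists2 v, ~ m v & v * (s * a) = 0.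
  by apply/to_local_eq0; rewrite rmorphM -e mulrA sx0 mul0r.
rewrite mulrCA => /rs va; have [w wu] := to_local_unit mu.
have a0 : to_local m a = 0 by apply/to_local_eq0; exists v.
by rewrite -(mulr1 x) -wu mulrA e a0 mul0r.
Qed.

Definition local_max : set (local_at m) :=
  [set x | exists a s, [/\ m a, ~ m s & x * to_local m s = to_local m a]].

Lemma local_max_ideal : ideal local_max.
Proof.
have [im _ mm] := pm; have [_ [m0 mD mM]] := im.
apply/idealE; split.
- by exists 0, 1; split=> //; [case: pm|rewrite mul0r rmorph0].
- move=> x y [a [s [ma ms ea]]] [b [u [mb mu eb]]]; exists (u * a + s * b), (s * u); split.
  + by apply: idealD => //; exact: idealMr.
  + exact: prime_not_mul.
  + by rewrite rmorphD !rmorphM -ea -eb; ring.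
- move=> x y _ [b [u [mb mu eb]]]; have [a [s [ms ea]]] := localP x.
  exists (a * b), (s * u); split; [exact: idealMr|exact: prime_not_mul|].
  by rewrite !rmorphM -ea -eb; ring.
Qed.

Lemma to_local_max a : m a -> local_max (to_local m a).
Proof. by move=> ma; exists a, 1; split=> //; [case: pm|rewrite rmorph1 mulr1]. Qed.

Lemma local_max_unit x : ~ local_max x -> exists y, x * y = 1.
Proof.
move=> nx; have [a [s [ms e]]] := localP x.
have [|v va] := @to_local_unit a; first by move=> ma; apply: nx; exists a, s.
by exists (to_local m s * v); rewrite mulrA e.
Qed.

Lemma local_max_to_local a : local_max (to_local m a) -> m a.
Proof.
have [im m1 mm] := pm.
move=> [b [s [mb ms e]]]; apply: contrapT => ma.
have : to_local m (a * s - b) = 0 by rewrite rmorphB rmorphM e subrr.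
case/to_local_eq0 => u mu e0.
have : m (u * (a * s - b) + u * b).
  by rewrite e0 add0r; exact: idealMr.
by rewrite -mulrDr subrK => /mm[//|/mm[]].
Qed.

Lemma local_max_proper : ~ local_max 1.
Proof. by rewrite -(rmorph1 (to_local m)) => /local_max_to_local; case: pm. Qed.

Lemma local_jacobson : @jacobson (local_at m) = local_max.
Proof.
have unit_out (I : set (local_at m)) : ideal I -> ~ I 1 -> I `<=` local_max.
  move=> iI I1 x Ix; apply: contrapT => /local_max_unit[y xy].
  by apply: I1; rewrite -xy; exact: idealMl.
have mL : Max (local_at m) local_max.
  split; [exact: local_max_ideal| |].
    by move=> e; apply: local_max_proper; rewrite e.
  move=> I iI LI; have [/ideal1|nI1] := pselect (I 1); first by right; auto.
  by left; apply/seteqP; split=> //; exact: unit_out.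
apply/seteqP; split=> [x|x Lx M mM]; first exact.
have <- // : local_max = M.
apply: (maximal_eq mM); [exact: local_max_ideal|exact: local_max_proper|].
by apply: unit_out; [exact: maximal_ideal|exact: maximal_not1].
Qed.

Lemma local_jacobson_unit (x : local_at m) : jacobson x -> exists y, (1 + x) * y = 1.
Proof.
rewrite local_jacobson => Lx; apply: local_max_unit => L1.
apply: local_max_proper; rewrite -(addrK x 1).
exact: (idealB local_max_ideal).
Qed.

End LocalAt.

(** * Reduced one-dimensional rings *)

(** The product of one element from each member of [F]. The property [Q] is regularity in one use
    and lying outside a fixed maximal ideal in the other. *)
Lemma ex_common_element (R : comPzRingType) (F : set (set R)) (Q : R -> Prop) :
  finite_set F -> (forall M, F M -> ideal M) -> Q 1 ->
  (forall a b, Q a -> Q b -> Q (a * b)) ->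
  (forall M, F M -> exists2 a, M a & Q a) ->
  exists2 a, Q a & forall M, F M -> M a.
Proof.
move=> /finite_seqP[s ->{F}] Fi Q1 QM FQ.
elim: s Fi FQ => [|M s IH] Fi FQ; first by exists 1.
have [|| a Qa sa] := IH.
- by move=> N /= Ns; apply: Fi; rewrite /= inE Ns orbT.
- by move=> N /= Ns; apply: FQ; rewrite /= inE Ns orbT.
have [b Mb Qb] := FQ M (mem_head _ _).
exists (a * b); first exact: QM.
move=> N /=; rewrite inE => /predU1P[->|Ns].
  by apply: idealMr Mb; apply: Fi; exact: mem_head.
by apply: idealMl (sa _ Ns); apply: Fi; rewrite /= inE Ns orbT.
Qed.

Section ReducedNoetherian.
Variable R : comPzRingType.
Hypothesis noethR : noetherian R.
Hypothesis redR : reduced R.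

(* Choose y in the annihilator of a with the largest biannihilator; an element
   z killed by a + y would allow replacing y by y + z. *)
Lemma ex_regular_add (a : R) : exists y, a * y = 0 /\ regular (a + y).
Proof.
pose biann (y : R) : set R := [set w | forall z, y * z = 0 -> w * z = 0].
have biann_ideal y : ideal (biann y).
  apply/idealE; split=> [z|u v yu yv z yz|c u _ yu z yz]; first by rewrite mul0r.
    by rewrite mulrDl yu // yv // addr0.
  by rewrite -mulrA yu // mulr0.
have sq0 (u : R) : u * u = 0 -> u = 0 by move=> uu; exact: (redR (n := 2)) uu.
have [||I [[y ay ->{I}] ymax]] := @noetherian_max _ noethR
    [set I | exists2 y, a * y = 0 & I = biann y] (biann 0).
- by exists 0; rewrite ?mulr0.
- by move=> _ [y _ ->].
(* The square of u w is w u (u + v) w - u v w^2 = 0. *)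
have split0 (u v w : R) : u * v = 0 -> (u + v) * w = 0 -> u * w = 0 /\ v * w = 0.
  move=> uv uvw.
  have uw : u * w = 0.
    apply: sq0; transitivity (w * u * ((u + v) * w) - u * v * (w * w)); first by ring.
    by rewrite uvw uv; ring.
  split=> //; rewrite -[RHS]uvw mulrDl uw add0r //.
exists y; split=> // z /(split0 _ _ _ ay)[az yz].
have ayz : a * (y + z) = 0 by rewrite mulrDr ay az addr0.
have e : biann (y + z) = biann y.
  apply: ymax; first by exists (y + z).
  by move=> w yw u /(split0 _ _ _ yz)[/yw].
have : biann y (y + z) by rewrite -e.
by move/(_ z yz); rewrite mulrDl yz add0r; exact: sq0.
Qed.

Hypothesis dimR : krull_dim R 1.

(** As [r] is regular, the products s r^k with s outside P are nonzero, so some prime [q] avoids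
    them all. It lies in P and misses r; if P were not maximal, q < P < M would be a chain of length
    2. *)
Lemma prime_regular_maximal (P : set R) r : prime_ideal P -> P r -> regular r -> Max R P.
Proof.
move=> pP Pr rr; have [iP P1 Pm] := pP; have [iT [P0 _ _]] := iP.
have [M mM PM] := ex_maximal noethR iP P1.
have [<-//|MP] := pselect (M = P).
have [||||q [pq _ qS]] := @ex_prime_avoiding _ noethR
    [set x | exists s k, ~ P s /\ x = s * r ^+ k] [set 0].
- by apply/idealE; split=> // [_ _ -> ->|c _ _ ->]; rewrite ?addr0 ?mulr0.
- by exists 1, 0%N; rewrite mulr1.
- move=> _ _ [s [k [Ps ->]]] [u [l [Pu ->]]]; exists (s * u), (k + l)%N.
  by split; [exact: prime_not_mul|rewrite exprD; ring].
- move=> _ -> [s [k [Ps /esym]]]; rewrite mulrC => /(regularX rr) s0.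
  by apply: Ps; rewrite s0.
have qP : q `<=` P.
  move=> x qx; apply: contrapT => Px; apply: (qS x qx).
  by exists x, 0%N; rewrite mulr1.
have nqr : ~ q r.
  by move=> qr; apply: (qS r qr); exists 1, 1%N; rewrite mul1r.
suff : (2 <= 1)%N by [].
apply: (dimR.2 (fun i => if i is i'.+1 then if i' is 0%N then P else M else q)).
split=> [[|[|[|//]]] _ //|[|[|//]] _]; first exact: maximal_prime.
  by split=> // Pq; apply: nqr; exact: Pq.
by split=> // MP'; apply: MP; apply/seteqP.
Qed.

(** Depth one gives a regular element a/s of R_m with a in m, but [a] may be a zero divisor in R. It
    is corrected to a regular a + y with a y = 0; then y vanishes in R_m, so it is killed by some
    element outside m and therefore lies in m. *)
Lemma ex_regular_maximal (m : set R) : Max R m -> local_depth (local_at m) 1 ->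
  exists2 a, m a & regular a.
Proof.
move=> mm [[s [[regs _] Js ss]] _]; have pm := maximal_prime mm.
case: s regs Js ss => [|x [|//]] // regs Js _.
have rx : regular x.
  move=> y xy; apply: ideal_gen_nil; apply: (regs 0%N) => //=.
  by rewrite xy; apply: ideal0; exact: ideal_gen_ideal.
have := Js x (mem_head _ _); rewrite local_jacobson // => -[a [s [ma ms e]]].
have [y [ay ray]] := ex_regular_add a.
exists (a + y) => //; apply: idealD => //; first exact: maximal_ideal.
have [_ _ mM] := pm.
have [v sv] := to_local_unit pm ms.
have : to_local m y = 0.
  apply: rx; transitivity (to_local m (a * y) * v); last by rewrite ay rmorph0 mul0r.
  by rewrite rmorphM -e -[LHS]mulr1 -sv; ring.
case/(to_local_eq0 pm) => u mu uy.
have [] // := mM u y.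
by rewrite uy; apply: ideal0; exact: maximal_ideal.
Qed.

Hypothesis finR : finite_set (Max R).

Lemma ex_regular_jacobson : (forall m, Max R m -> local_depth (local_at m) 1) ->
  exists2 t : R, jacobson t & regular t.
Proof.
move=> depthR; have [||||t rt Jt] := @ex_common_element R (Max R) (@regular R) finR.
- exact: maximal_ideal.
- exact: regular1.
- exact: regularM.
- by move=> m mm; apply: ex_regular_maximal => //; exact: depthR.
by exists t.
Qed.

Lemma dvd_regular_exp (t r : R) : jacobson t -> regular r -> exists k, principal r (t ^+ k).
Proof.
move=> Jt rr; apply: radical_primes => //; first exact: principal_ideal.
move=> P pP rP; apply: Jt; apply: (@prime_regular_maximal P r) => //.
by apply: rP; exists 1; rewrite mul1r.
Qed.

Lemma jpower_sub_regular (t : R) : regular t -> exists K, @jpower R K `<=` principal t.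
Proof.
move=> rt; apply: jpower_radical => //; first exact: principal_ideal.
by move=> a Ja; exact: dvd_regular_exp.
Qed.

Lemma artinian_principal (t : R) (D : nat -> set R) : regular t ->
  (forall n, ideal (D n)) -> (forall n, D n.+1 `<=` D n) -> (forall n, D n t) ->
  exists n, forall m, (n <= m)%N -> D m = D n.
Proof.
move=> rt iD sD Dt; apply: (artinian_above noethR (principal_ideal t)) => //.
  move=> P pP tP; apply: (@prime_regular_maximal P t) => //.
  by apply: tP; exists 1; rewrite mul1r.
by move=> n _ [b ->]; exact: idealMr.
Qed.

(* The idempotent of R / t cutting out the maximal ideal m: the powers of an
   element c lying in every other maximal ideal but not in m stabilise. *)
Lemma ex_idempotent_mod (t : R) (m : set R) : jacobson t -> regular t -> Max R m ->
  exists e, [/\ principal t (e * e - e), m (1 - e)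
              & forall v, ~ m v -> exists k b c, e ^+ k = b * v + c * t].
Proof.
move=> Jt rt mm; have im := maximal_ideal mm; have pm := maximal_prime mm.
have [|||||c mc Mc] := @ex_common_element R [set M | Max R M /\ M <> m] (~` m).
- by apply: sub_finite_set finR => M [].
- by move=> M [/maximal_ideal].
- exact: maximal_not1.
- by move=> a b; exact: prime_not_mul.
- move=> M [mM Mm]; apply: contrapT => noa; apply: Mm.
  have [_ _ Mmax] := mM; apply/esym/(maximal_eq mM) => //; first exact: maximal_not1.
  by move=> x Mx; apply: contrapT => mx; apply: noa; exists x.
have [|||n nP] := @artinian_principal t (fun n => ideal_add (principal (c ^+ n)) t) rt.
- by move=> n; exact/ideal_add_ideal/principal_ideal.
- move=> n _ [_ [b ->] [d ->]]; exists (b * c ^+ n.+1); last by exists d.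
  by exists (b * c); rewrite exprS mulrA.
- by move=> n; exact/ideal_add_mem/principal_ideal.
(* Stability gives c^(n+1) = b c^(2n+2) + d t, so that b c^(n+1) is idempotent modulo t. The
   exponent is taken positive in order that c divides this idempotent. *)
have : ideal_add (principal (c ^+ (n.+1 + n.+1))) t (c ^+ n.+1).
  rewrite nP ?(leq_trans (leqnSn n)) ?leq_addr // -(nP n.+1) ?leqnSn //.
  by exists (c ^+ n.+1); [exists 1; rewrite mul1r|exists 0; rewrite mul0r addr0].
case=> _ [b ->] [d ed].
have mcn : ~ m (c ^+ n.+1) by move=> /(prime_exp pm).
have ee : principal t (b * c ^+ n.+1 * (b * c ^+ n.+1) - b * c ^+ n.+1).
  exists (- (b * d)); rewrite [X in _ - b * X]ed exprD; ring.
exists (b * c ^+ n.+1); split=> //.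
  have [_ _ mM] := pm; have [] // := mM (c ^+ n.+1) (1 - b * c ^+ n.+1).
  have -> : c ^+ n.+1 * (1 - b * c ^+ n.+1) = d * t.
    by rewrite mulrBr mulr1 {1}ed exprD; ring.
  by apply: idealMr => //; exact: Jt.
move=> v mv.
have [||k [_ [b' ->] [c' e]]] := @radical_primes _ noethR
    (ideal_add (principal v) t) (b * c ^+ n.+1).
- exact/ideal_add_ideal/principal_ideal.
- move=> P pP vP; have tP : P t by apply: vP; exact/ideal_add_mem/principal_ideal.
  have mP := prime_regular_maximal pP tP rt.
  have cP : P c.
    apply: Mc; split=> // e; apply: mv; rewrite -e; apply: vP.
    by exists v; [exists 1; rewrite mul1r|exists 0; rewrite mul0r addr0].
  by rewrite exprS; apply: idealMr (maximal_ideal mP) _; apply: idealMl (maximal_ideal mP) _.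
by exists k, b', c'.
Qed.

End ReducedNoetherian.

(** * Completion *)

Section CompletionSequences.
Variable A : comPzRingType.

(** Detaches the sequence from the coherence proof packed into a [family], so that elements of the
    completion can be computed with termwise. *)
Definition represents (x : hat A) (f : nat -> A) : Prop :=
  exists2 u : Defs.family A, x = \pi_(completion A) u & reps u = f.

Lemma ex_represents (x : hat A) : exists f, represents x f.
Proof. by elim/quotW: x => u; exists (reps u), u. Qed.

Lemma represents_lim (f : nat -> A) :
  (forall n, jpower n (f n.+1 - f n)) -> exists x, represents x f.
Proof.
move=> cf; have hf : f \in @coherent A by apply/asboolP.
by exists (\pi_(completion A) (Family hf)), (Family hf).
Qed.

Lemma represents_coherent x f : represents x f -> forall n, jpower n (f n.+1 - f n).
Proof. by move=> [[u cu] _ <-]; exact/asboolP. Qed.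

Lemma represents_coherent_le x f m n : represents x f -> (m <= n)%N ->
  jpower m (f n - f m).
Proof.
move=> xf /subnK <-; elim: (n - m)%N => [|k IH].
  by rewrite subrr; exact: jpower0.
rewrite addSn -[f _](subrK (f (k + m)%N)) -addrA.
apply: idealD IH; first exact: jpower_ideal.
by apply: (jpower_le (leq_addl k m)); exact: represents_coherent xf _.
Qed.

Lemma represents_eq x y f g : represents x f -> represents y g ->
  x = y <-> forall n, jpower n (f n - g n).
Proof. by move=> [u -> <-] [v -> <-]; exact: completion_eqP. Qed.

Lemma represents_to_hat a : represents (to_hat A a) (fun=> a).
Proof. by exists (Family (cst_coherent a)). Qed.

Lemma represents0 : represents (0 : hat A) (fun=> 0).
Proof. by rewrite -(rmorph0 (to_hat A)); exact: represents_to_hat. Qed.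

Lemma represents1 : represents (1 : hat A) (fun=> 1).
Proof. by rewrite -(rmorph1 (to_hat A)); exact: represents_to_hat. Qed.

Lemma representsD x y f g : represents x f -> represents y g ->
  represents (x + y) (fun n => f n + g n).
Proof.
move=> [u -> <-] [v -> <-]; exists (u + v).
  by rewrite -[LHS]completion_pi_add.
by apply/funext => n; rewrite repsD.
Qed.

Lemma representsM x y f g : represents x f -> represents y g ->
  represents (x * y) (fun n => f n * g n).
Proof.
move=> [u -> <-] [v -> <-]; exists (u * v).
  by rewrite -[LHS]completion_pi_mul.
by apply/funext => n; rewrite repsM.
Qed.

Lemma to_hat_eq0 a : to_hat A a = 0 <-> forall n, jpower n a.
Proof.
rewrite (represents_eq (represents_to_hat a) represents0).
by split=> h n; move: (h n); rewrite subr0.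
Qed.

End CompletionSequences.

Section Completion.
Variables (A : comPzRingType) (t : A) (K : nat).
Hypothesis rt : regular t.
Hypothesis Jt : jacobson t.
Hypothesis JK : jpower K `<=` principal t.

Let th : hat A := to_hat A t.

Lemma jpower_dvdK n x : jpower (K * n) x -> principal (t ^+ n) x.
Proof. exact: jpower_principal. Qed.

Lemma hat_regular : regular th.
Proof.
move=> x; have [f xf] := ex_represents x.
have tf := representsM (represents_to_hat t) xf.
move/(represents_eq tf (represents0 A)) => tf0.
apply/(represents_eq xf (represents0 A)) => n; rewrite subr0.
(* Far enough that t f(N) lies in t^(n+1) A. Cancelling one t leaves t^n, and f(N) still agrees with
   f(n) modulo J^n. *)
set N := (n + K * n.+1)%N.
have := tf0 N; rewrite subr0 => /(jpower_le (leq_addl n _))/jpower_dvdK[b eb].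
have fN : f N = b * t ^+ n by apply: (regular_inj rt); rewrite eb exprS; ring.
have -> : f n = f N - (f N - f n) by ring.
apply: idealB; [exact: jpower_ideal| |].
  by apply: (jpower_dvd Jt); exists b.
by apply: represents_coherent_le xf _; exact: leq_addr.
Qed.

(** Along the subsequence of indices K (n+1), all differences from f(K) are divisible by t. The
    quotients form a coherent sequence because consecutive terms differ by a multiple of t^(n+1), of
    which t^n survives the division. *)
Lemma hat_split x : exists a w, x = to_hat A a + w * th.
Proof.
have [f xf] := ex_represents x.
have /choice[g gP] n : exists b, f (K * n.+1)%N - f K = b * t.
  have : jpower K (f (K * n.+1)%N - f K).
    by apply: represents_coherent_le xf _; rewrite leq_pmulr.
  by move/JK.
have [n|w wg] := @represents_lim A g.
  apply: (jpower_dvd Jt).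
  have : jpower (K * n.+1) (f (K * n.+2)%N - f (K * n.+1)%N).
    by apply: represents_coherent_le xf _; rewrite leq_mul2l ltnW ?orbT.
  move/jpower_dvdK => [b eb]; exists b; apply: (regular_inj rt).
  transitivity (f (K * n.+2)%N - f (K * n.+1)%N); last by rewrite eb exprS; ring.
  rewrite mulrBr ![t * _]mulrC -!gP; ring.
exists (f K), w.
apply/(represents_eq xf (representsD (represents_to_hat _) (representsM wg (represents_to_hat t)))).
move=> n; rewrite -gP [f K + _]addrC subrK.
(* For K = 0 the indices K (n+1) are not cofinal, but then t is a unit and every J^n is the whole
   ring. *)
have [K0|K0] := posnP K.
  have [b e1] : principal t 1 by apply: JK; rewrite K0.
  apply: (jpower_dvd Jt); exists ((f n - f (K * n.+1)%N) * b ^+ n).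
  by rewrite -mulrA -exprMn -e1 expr1n mulr1.
rewrite -opprB -mulN1r; apply: idealMr; first exact: jpower_ideal.
by apply: represents_coherent_le xf _; rewrite (leq_trans (leqnSn n)) // leq_pmull.
Qed.

Lemma hat_principal a : principal th (to_hat A a) -> principal t a.
Proof.
move=> [w]; have [f wf] := ex_represents w.
move/(represents_eq (represents_to_hat a) (representsM wf (represents_to_hat t))).
move/(_ K)/JK => [b e]; exists (b + f K).
by rewrite mulrDl -e subrK.
Qed.

Lemma hat_separated x : (forall n, principal (th ^+ n) x) -> x = 0.
Proof.
move=> tx; have [f xf] := ex_represents x.
apply/(represents_eq xf (represents0 A)) => n; rewrite subr0.
have [w] := tx n; have [g wg] := ex_represents w.
rewrite /th -rmorphXn.
move/(represents_eq xf (representsM wg (represents_to_hat (t ^+ n))))/(_ n) => Jf.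
rewrite -(subrK (g n * t ^+ n) (f n)); apply: idealD Jf _; first exact: jpower_ideal.
by apply: (jpower_dvd Jt); exists (g n).
Qed.

(** The series with digits [r] together with all its tails: s n is the sum of the r (n + i) t^i.
    Having the tails makes each use a one-step recursion. *)
Lemma hat_series (r : nat -> A) :
  exists s : nat -> hat A, forall n, s n = to_hat A (r n) + s n.+1 * th.
Proof.
pose S m n := \sum_(i < n) r (m + i)%N * t ^+ i.
have /choice[s sP] m : exists x, represents x (S m).
  apply: represents_lim => n; apply: (jpower_dvd Jt).
  by exists (r (m + n)%N); rewrite /S big_ord_recr /= addrAC subrr add0r.
exists s => m.
apply/(represents_eq (sP m) (representsD (represents_to_hat _)
  (representsM (sP _) (represents_to_hat t)))).
move=> n; apply: (jpower_dvd Jt); exists (- r (m + n)%N).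
have -> : r m + S m.+1 n * t = S m n.+1.
  rewrite /S big_ord_recl /= addn0 expr0 mulr1 mulr_suml; congr (_ + _).
  by apply: eq_bigr => i _; rewrite /bump /= addSnnS exprSr mulrA.
by rewrite /S big_ord_recr /=; ring.
Qed.

Hypothesis unitJ : forall a : A, jacobson a -> exists b, (1 + a) * b = 1.

Lemma hat_unit (w : hat A) : exists v, (1 + w * th) * v = 1.
Proof.
have [f wf] := ex_represents w.
have /choice[g gP] n : exists b, (1 + f n * t) * b = 1.
  by apply: unitJ; exact: idealMr (jacobson_ideal A) Jt.
have [n|v vg] := @represents_lim A g.
  have -> : g n.+1 - g n = - (g n.+1 * g n * t) * (f n.+1 - f n).
    transitivity (((1 + f n * t) * g n) * g n.+1 - ((1 + f n.+1 * t) * g n.+1) * g n).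
      by rewrite !gP; ring.
    ring.
  by apply: idealMr; [exact: jpower_ideal|exact: represents_coherent wf _].
exists v.
have e : represents ((1 + w * th) * v) (fun n => (1 + f n * t) * g n).
  apply: representsM vg; apply: representsD (representsM wf (represents_to_hat t)).
  exact: represents1.
apply/(represents_eq e (represents1 A)) => n.
by rewrite gP subrr; exact: jpower0.
Qed.

End Completion.

(** * Regular elements of the completion divide powers of t *)

Section HatRegular.
Variables (A : comPzRingType) (t : A) (K : nat).
Hypothesis noethA : noetherian A.
Hypothesis rt : regular t.
Hypothesis Jt : jacobson t.
Hypothesis JK : jpower K `<=` principal t.
Hypothesis artA : forall D : nat -> set A,
  (forall n, ideal (D n)) -> (forall n, D n.+1 `<=` D n) -> (forall n, D n t) ->
  exists n, forall m, (n <= m)%N -> D m = D n.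

Let th : hat A := to_hat A t.

(* Nakayama's lemma for a t-saturated ideal I, by successive approximation. *)
Lemma hat_ideal_sub (I H : set (hat A)) : ideal H -> H `<=` I ->
  ideal I -> (forall x, I (x * th) -> I x) ->
  (forall x, I x -> exists2 y, H y & principal th (x - y)) -> I `<=` H.
Proof.
move=> iH HI iI satI IHt.
(* [D] is H read modulo t. It is finitely generated, being an ideal of A, and its generators lift to
   the elements [g i] of H, which will generate I. *)
pose D : set A := [set a | exists2 y, H y & principal th (to_hat A a - y)].
have iD : ideal D.
  have ip := principal_ideal th.
  apply/idealE; split.
  - by exists 0; [exact: ideal0|rewrite rmorph0 subr0; exact: ideal0].
  - move=> a b [y Hy py] [z Hz pz]; exists (y + z); first exact: idealD.
    by rewrite rmorphD opprD addrACA; exact: idealD.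
  - move=> c a _ [y Hy py]; exists (to_hat A c * y); first exact: idealMr.
    by rewrite rmorphM -mulrBr; exact: idealMr.
have [s Ds] := noethA iD.
have /choice[g gP] (i : 'I_(size s)) : exists y, H y /\ principal th (to_hat A s`_i - y).
  have : D s`_i by rewrite Ds; apply: ideal_gen_mem; exact: mem_nth.
  by case=> y; exists y.
have /choice[step stepP] x : exists cx : ('I_(size s) -> A) * hat A, I x ->
    I cx.2 /\ x = \sum_i to_hat A (cx.1 i) * g i + cx.2 * th.
  have [Ix|nIx] := pselect (I x); last by exists (fun=> 0, 0).
  have [y Hy [w ew]] := IHt x Ix.
  have [a [w' ex]] := hat_split rt Jt JK x.
  have : D a.
    exists y => //; exists (w - w'); rewrite mulrBl -ew ex; ring.
  rewrite Ds => /ideal_genP[c ec].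
  have : principal th (to_hat A a - \sum_i to_hat A (c i) * g i).
    rewrite ec rmorph_sum -sumrB; apply: (submodule_sum (A := setT)).
      by apply/idealE; exact: principal_ideal.
    move=> i _; rewrite rmorphM -mulrBr; apply: idealMr; first exact: principal_ideal.
    by have [] := gP i.
  case=> v ev; exists (c, v + w') => _.
  have e : x = \sum_i to_hat A (c i) * g i + (v + w') * th.
    by rewrite mulrDl -ev ex; ring.
  split=> //=; apply: satI.
  have -> : (v + w') * th = x - \sum_i to_hat A (c i) * g i.
    by rewrite [in RHS]e; ring.
  apply: idealB => //; apply: HI; apply: (submodule_sum (A := setT)).
    exact/idealE.
  by move=> i _; apply: idealMr => //; have [] := gP i.
move=> x Ix; pose z n := iter n (fun x => (step x).2) x.
have Iz n : I (z n) by elim: n => // n IH; exact: (stepP _ IH).1.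
have /choice[c cP] i := hat_series Jt (fun n => (step (z n)).1 i).
(* The coefficients of all approximation steps are summed into the series [c i]. Each step gains one
   factor t, so the final error lies in every t^n R^. *)
have e n : z n - \sum_i c i n * g i = (z n.+1 - \sum_i c i n.+1 * g i) * th.
  rewrite [X in X - _](stepP _ (Iz n)).2 -/(z n.+1) mulrBl addrAC -sumrB addrC.
  congr (_ + _); rewrite mulr_suml -sumrN; apply: eq_bigr => i _.
  by rewrite (cP i n); ring.
have : x - \sum_i c i 0%N * g i = 0.
  apply: (hat_separated Jt) => n; exists (z n - \sum_i c i n * g i).
  rewrite -/(z 0%N); elim: n => [|n ->]; first by rewrite mulr1.
  by rewrite e exprS mulrA.
move/eqP; rewrite subr_eq0 => /eqP ->.
apply: (submodule_sum (A := setT)); first exact/idealE.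
by move=> i _; apply: idealMr => //; have [] := gP i.
Qed.

(* The argument of Krull's principal ideal theorem, with the t-saturation of
   (r^n) in place of a symbolic power. *)
Lemma hat_dvd_regular_exp (r : hat A) : regular r -> exists k, principal r (th ^+ k).
Proof.
move=> rr.
pose I n : set (hat A) := [set z | exists k, principal (r ^+ n) (z * th ^+ k)].
have iI n : ideal (I n).
  have ip := principal_ideal (r ^+ n); apply/idealE; split.
  - by exists 0%N; rewrite mul0r; exact: ideal0.
  - move=> x y [k px] [l py]; exists (k + l)%N; rewrite mulrDl; apply: idealD => //.
      by rewrite exprD mulrA; exact: idealMl.
    by rewrite addnC exprD mulrA; exact: idealMl.
  - by move=> c x _ [k px]; exists k; rewrite -mulrA; exact: idealMr.
have satI n x : I n (x * th) -> I n x.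
  by move=> [k]; rewrite -mulrA -exprS; exists k.+1.
have sI n : I n.+1 `<=` I n.
  by move=> x [k [b e]]; exists k, (b * r); rewrite e exprS mulrA.
pose D n : set A := [set a | exists2 y, I n y & principal th (to_hat A a - y)].
have ip := principal_ideal th.
(* Where the chain of residues stabilises, I n is contained in I (n+1) + tR^, hence in I (n+1). For
   r^n this reads r^n t^k = b r^(n+1), and r^n cancels. *)
have [|||n nP] := artA (D := D).
- move=> n; apply/idealE; split.
  + by exists 0; [exact: ideal0|rewrite rmorph0 subr0; exact: ideal0].
  + move=> a b [y Hy py] [z Hz pz]; exists (y + z); first exact: idealD.
    by rewrite rmorphD opprD addrACA; exact: idealD.
  + move=> c a _ [y Hy py]; exists (to_hat A c * y); first exact: idealMr.
    by rewrite rmorphM -mulrBr; exact: idealMr.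
- by move=> n a [y /sI Iy ?]; exists y.
- by move=> n; exists 0; [exact: ideal0|exists 1; rewrite subr0 mul1r].
have : I n `<=` I n.+1.
  apply: hat_ideal_sub (iI _) (sI n) (iI n) (satI n) _ => x Ix.
  have [a [w ex]] := hat_split rt Jt JK x.
  have : D n.+1 a.
    by rewrite nP //; exists x => //; exists (- w); rewrite ex; ring.
  case=> y Iy [v ev]; exists y => //; exists (v + w); rewrite mulrDl -ev ex; ring.
have Irn : I n (r ^+ n) by exists 0%N, 1; rewrite mulr1 mul1r.
move=> /(_ _ Irn)[k [b e]]; exists k, b.
apply: (@regular_inj (hat A) (r ^+ n)); first exact: regularX.
by rewrite e exprS; ring.
Qed.

End HatRegular.

(** * Extension of fractional ideals *)

Section FractionMaps.

Lemma ex_frac_map (A B : comPzRingType) (f : {rmorphism A -> B}) :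
  (forall s, regular s -> regular (f s)) ->
  exists i : {rmorphism total_frac A -> total_frac B},
    forall a, i (to_frac A a) = to_frac B (f a).
Proof.
move=> fr.
have [|||||i iP] := @rmorph_of_rel (total_frac A) (total_frac B) (fun x y => exists a s,
    [/\ regular s, x * to_frac A s = to_frac A a & y * to_frac B (f s) = to_frac B (f a)]).
- move=> x; have [a [s [rs e]]] := fracP x.
  have [v sv] := to_frac_unit (fr s rs); exists (to_frac B (f a) * v), a, s; split=> //.
  by rewrite -mulrA [v * _]mulrC sv mulr1.
- by exists 1, 1; split; [exact: regular1|rewrite mul1r|rewrite mul1r].
- move=> x y x' y' [a [s [rs e1 e2]]] [b [u [ru e3 e4]]].
  exists (a * u - b * s), (s * u); split; first exact: regularM.
    by rewrite !(rmorphB, rmorphM) -e1 -e3; ring.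
  by rewrite !(rmorphB, rmorphM) /= -e2 -e4; ring.
- move=> x y x' y' [a [s [rs e1 e2]]] [b [u [ru e3 e4]]].
  exists (a * b), (s * u); split; first exact: regularM.
    by rewrite !rmorphM -e1 -e3; ring.
  by rewrite !rmorphM /= -e2 -e4; ring.
- move=> y [a [s [rs e1 e2]]]; apply: (to_frac_regular (fr s rs)).
  have /to_frac_inj a0 : to_frac A a = to_frac A 0 by rewrite -e1 mul0r rmorph0.
  by rewrite mulrC e2 a0 !rmorph0.
exists i => a; apply/esym/iP; exists a, 1; split; first exact: regular1.
  by rewrite rmorph1 mulr1.
by rewrite !rmorph1 mulr1.
Qed.

Lemma frac_map_unique (A B : comPzRingType) (i j : {rmorphism total_frac A -> B}) :
  (forall a, i (to_frac A a) = j (to_frac A a)) -> i =1 j.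
Proof.
move=> ij x; have [a [s [rs e]]] := fracP x; have [v sv] := to_frac_unit rs.
have -> : x = to_frac A a * v by rewrite -e -mulrA sv mulr1.
rewrite !rmorphM ij; congr (_ * _).
have jsv : j (to_frac A s) * j v = 1 by rewrite -rmorphM sv rmorph1.
rewrite -[LHS]mul1r -jsv mulrAC -ij -rmorphM sv rmorph1 mul1r //.
Qed.

Lemma extendE (A B : comPzRingType) (f : {rmorphism A -> B})
    (i : {rmorphism total_frac A -> total_frac B}) :
  (forall s, regular s -> regular (f s)) ->
  (forall a, i (to_frac A a) = to_frac B (f a)) ->
  forall E, extend f E = prod_ideal (@ring_in_frac B) (i @` E).
Proof.
move=> fr iP E; rewrite /extend; congr prod_ideal; apply/seteqP; split=> y.
  move=> [a [s [rs rfs [x Ex e1] e2]]]; exists x => //.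
  apply: (regular_inj (to_frac_regular rfs)).
  by rewrite mulrC -[in LHS]iP -rmorphM e1 iP -e2 mulrC.
move=> [x Ex <-]; have [a [s [rs e]]] := fracP x.
by exists a, s; split; [| exact: fr|exists x|rewrite -iP -rmorphM e iP].
Qed.

(** Functoriality; it turns both sides of the last condition in [identified] into the extension of V
    along one and the same map. *)
Lemma extend_comp (A B C : comPzRingType) (f : {rmorphism A -> B})
    (g : {rmorphism B -> C}) (h : {rmorphism A -> C}) E :
  (forall s, regular s -> regular (f s)) -> (forall s, regular s -> regular (g s)) ->
  (forall a, g (f a) = h a) -> extend g (extend f E) = extend h E.
Proof.
move=> fr gr gf; have hr s : regular s -> regular (h s) by rewrite -gf; auto.
have [i iP] := ex_frac_map fr; have [j jP] := ex_frac_map gr.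
have [k kP] := ex_frac_map hr.
have ji x : j (i x) = k x.
  by apply: (@frac_map_unique _ _ (j \o i) k) => a /=; rewrite iP jP gf kP.
rewrite (extendE gr jP) (extendE fr iP) (extendE hr kP).
have [S0 SD SM] := ring_in_frac_submodule C.
apply/seteqP; split; apply: prod_ideal_ind; try exact: add_span0; try exact: add_spanD.
  move=> c _ Cc [x Ex <-].
  move: x Ex; apply: (@prod_ideal_ind _ _ _ [set x | prod_ideal _ _ (c * j x)]).
  - by rewrite /= rmorph0 mulr0; exact: add_span0.
  - by move=> x y; rewrite /= rmorphD mulrDr; exact: add_spanD.
  move=> _ _ [b _ <-] [x Ex <-]; rewrite /= rmorphM ji jP mulrA.
  apply: prod_ideal_sub; last by exists x.
  by apply: SM => //; exact: to_frac_ring.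
move=> c _ Cc [x Ex <-]; apply: prod_ideal_sub => //; exists (i x) => //.
rewrite -(mul1r (i x)); apply: prod_ideal_sub; last by exists x.
by rewrite -(rmorph1 (to_frac B)); exact: to_frac_ring.
Qed.

End FractionMaps.

(** * Valuation rings *)

Section ValuationRings.
Variable A : comPzRingType.
Implicit Types V M : set (total_frac A).

Definition regular_maximal V M : Prop :=
  maximal_ideal_of V M /\ exists x, M x /\ regular x.

Lemma valuation_rings1 V : valuation_rings A V -> V 1.
Proof. by move=> [[/set_mem]]. Qed.

Lemma valuation_ringsB V x y : valuation_rings A V -> V x -> V y -> V (x - y).
Proof. by move=> [[_ VB _] _ _ _] Vx Vy; apply/set_mem/VB; exact/mem_set. Qed.

Lemma valuation_ringsM V x y : valuation_rings A V -> V x -> V y -> V (x * y).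
Proof. by move=> [[_ _ VM] _ _ _] Vx Vy; apply/set_mem/VM; exact/mem_set. Qed.

Lemma valuation_ringsD V x y : valuation_rings A V -> V x -> V y -> V (x + y).
Proof.
move=> vV Vx Vy; rewrite -[y]opprK; apply: valuation_ringsB => //.
rewrite -sub0r; apply: valuation_ringsB => //.
by rewrite -(subrr 1); apply: valuation_ringsB; rewrite //; exact: valuation_rings1.
Qed.

Lemma valuation_rings_submodule V : valuation_rings A V -> submodule V V.
Proof.
move=> vV; split=> [|x y|a x]; [|exact: valuation_ringsD|exact: valuation_ringsM].
by rewrite -(subrr 1); apply: valuation_ringsB; rewrite //; exact: valuation_rings1.
Qed.

Lemma valuation_rings_base V a : valuation_rings A V -> V (to_frac A a).
Proof. by move=> [_ AV _ _]; apply: AV; exact: to_frac_ring. Qed.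

Lemma valuation_rings_mul V x y : valuation_rings A V -> V (x * y) -> V x \/ V y.
Proof.
move=> [_ _ _ VC] Vxy; apply: contrapT => /not_orP[Vx Vy]; exact: (VC x y).
Qed.

Lemma valuation_rings_neqT V : valuation_rings A V -> exists x, ~ V x.
Proof.
move=> [_ _ VT _]; apply: contrapT => noV; apply: VT.
by apply/seteqP; split=> // x _; apply: contrapT => Vx; apply: noV; exists x.
Qed.

Lemma regular_maximal_not1 V M : valuation_rings A V -> regular_maximal V M -> ~ M 1.
Proof.
move=> vV [[[MV [_ _ MM]] VM _] _] M1; apply: (VM); apply/seteqP; split=> // x Vx.
by rewrite -(mulr1 x); exact: MM.
Qed.

Variable t : A.
Hypothesis rt : regular t.
Hypothesis dvdt : forall r : A, regular r -> exists k, principal r (t ^+ k).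

Let tq : total_frac A := to_frac A t.

Lemma frac_denom (x : total_frac A) : exists k a, x * tq ^+ k = to_frac A a.
Proof.
have [a [s [rs e]]] := fracP x; have [k [b eb]] := dvdt rs.
by exists k, (b * a); rewrite /tq -rmorphXn eb !rmorphM -e; ring.
Qed.

Lemma submodule_denom (E : set (total_frac A)) x : submodule (@ring_in_frac A) E ->
  E x -> regular x -> exists k, E (tq ^+ k).
Proof.
move=> [_ _ EM] Ex /frac_unit[y xy]; have [k [a e]] := frac_denom y.
exists k; have -> : tq ^+ k = to_frac A a * x by rewrite -e -[LHS]mul1r -xy; ring.
by apply: EM => //; exact: to_frac_ring.
Qed.

Lemma valuation_rings_inv V v : valuation_rings A V -> tq * v = 1 -> ~ V v.
Proof.
move=> vV tv Vv; have [x nVx] := valuation_rings_neqT vV; apply: nVx.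
have [k [a e]] := frac_denom x.
have -> : x = to_frac A a * v ^+ k by rewrite -e -mulrA unitX // mulr1.
apply: valuation_ringsM => //; first exact: valuation_rings_base.
elim: k {e} => [|k IH]; first by rewrite expr0; exact: valuation_rings1.
by rewrite exprS; exact: valuation_ringsM.
Qed.

Hypothesis von_neumann : forall x : total_frac A, exists y, x * x * y = x.

(** The elements invertible in V/tV. Since Q may be a product of fields, V can have further maximal
    ideals that are not regular; they do not contain t, so V/tV does not see them and turns out to
    be local. *)
Definition unit_mod V : set (total_frac A) :=
  [set x | exists b c, [/\ V b, V c & x * b = 1 + c * tq]].

Lemma unit_mod_split V a : valuation_rings A V -> V a -> unit_mod V a \/ unit_mod V (1 - a).
Proof.
move=> vV Va.
have VD x y := @valuation_ringsD V x y vV; have VM x y := @valuation_ringsM V x y vV.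
have VB x y := @valuation_ringsB V x y vV; have V1 := valuation_rings1 vV.
have V0 : V 0 by rewrite -(subrr 1); exact: VB.
have [v tv] := to_frac_unit rt.
(* The product of e/t and (1-e)/t is 0, which lies in V, hence one of the two factors does. *)
have idem_lift (e : total_frac A) : e * e = e ->
    (exists2 c, V c & e = c * tq) \/ exists2 c, V c & 1 - e = c * tq.
  move=> ee; have [] := @valuation_rings_mul V (e * v) ((1 - e) * v) vV.
  - have -> : e * v * ((1 - e) * v) = (e - e * e) * v ^+ 2 by ring.
    by rewrite ee subrr mul0r.
  - by move=> Vev; left; exists (e * v) => //; rewrite -mulrA [v * _]mulrC tv mulr1.
  - by move=> Vev; right; exists ((1 - e) * v) => //; rewrite -mulrA [v * _]mulrC tv mulr1.
have unit_of x y : V x -> V y -> x * x * y = x -> unit_mod V x \/ unit_mod V (1 - x).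
  move=> Vx Vy e; have [|[c Vc ec]|[c Vc ec]] := idem_lift (x * y).
  - by transitivity (x * x * y * y); [ring|rewrite e].
  - right; exists 1, (- (x * c)); split=> //; first by rewrite -sub0r; apply: (VB) => //; exact: VM.
    have -> : - (x * c) * tq = - (x * (x * y)) by rewrite ec; ring.
    by rewrite mulrA e mulr1.
  - left; exists y, (- c); split=> //; first by rewrite -sub0r; exact: VB.
    by rewrite mulNr -ec; ring.
have [a' ea] := von_neumann a; have [b' eb] := von_neumann (1 - a).
have idem (x y : total_frac A) : x * x * y = x -> V (x * y).
  move=> e; have xyxy : x * y * (x * y) = x * y by transitivity (x * x * y * y); [ring|rewrite e].
  have [] := @valuation_rings_mul V (x * y) (1 - x * y) vV => // [|V1xy].
    by rewrite mulrBr mulr1 xyxy subrr.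
  by rewrite -(subKr 1 (x * y)); exact: VB.
(* The weak inverses a' of a and b' of 1 - a need not lie in V, but the idempotents a a' and (1-a)
   b' do. Regrouping their product puts a b' or (1-a) a' into V, and with it b' or a'. *)
have [] := @valuation_rings_mul V (a * b') ((1 - a) * a') vV.
- have -> : a * b' * ((1 - a) * a') = (a * a') * ((1 - a) * b') by ring.
  by apply: (VM); exact: idem.
- move=> Vab; have [||] := unit_of _ b' (VB _ _ V1 Va) _ eb; [|by right|by rewrite subKr; left].
  have -> : b' = a * b' + (1 - a) * b' by ring.
  by apply: (VD) => //; exact: idem.
- move=> Vba; apply: (unit_of _ a' Va _ ea).
  have -> : a' = (1 - a) * a' + a * a' by ring.
  by apply: (VD) => //; exact: idem.
Qed.

Lemma unit_modM V x y : valuation_rings A V -> V x -> V y ->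
  unit_mod V (x * y) <-> unit_mod V x /\ unit_mod V y.
Proof.
move=> vV Vx Vy.
have VD u w := @valuation_ringsD V u w vV; have VM u w := @valuation_ringsM V u w vV.
have Vt := valuation_rings_base t vV.
split=> [[b [c [Vb Vc e]]]|[[b [c [Vb Vc e]]] [b' [c' [Vb' Vc' e']]]]].
  split; [exists (y * b), c|exists (x * b), c]; split; try exact: VM; try done.
    by rewrite mulrA.
  by rewrite mulrCA mulrA.
exists (b * b'), (c + c' + c * c' * tq); split; [exact: VM| |].
  by apply: (VD); [exact: VD|apply: (VM) => //; exact: VM].
transitivity (x * b * (y * b')); first by ring.
by rewrite e e'; ring.
Qed.

Lemma unit_mod_t V : valuation_rings A V -> ~ unit_mod V tq.
Proof.
move=> vV [b [c [Vb Vc e]]]; have [v tv] := to_frac_unit rt.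
apply: (valuation_rings_inv vV tv).
have -> : v = b - c.
  rewrite -[v]mul1r; have -> : 1 = tq * b - c * tq by rewrite e addrK.
  by rewrite -[RHS]mulr1 -tv; ring.
exact: valuation_ringsB.
Qed.

Definition nonunits V : set (total_frac A) := [set x | V x /\ ~ unit_mod V x].

Lemma nonunits_regular_maximal V : valuation_rings A V -> regular_maximal V (nonunits V).
Proof.
move=> vV.
have VD u w := @valuation_ringsD V u w vV; have VM u w := @valuation_ringsM V u w vV.
have VB u w := @valuation_ringsB V u w vV; have V1 := valuation_rings1 vV.
have Vt := valuation_rings_base t vV.
have Pt : nonunits V tq by split=> //; exact: unit_mod_t.
have Usub x c : V x -> V c -> unit_mod V (x - c * tq) -> unit_mod V x.
  move=> Vx Vc [b [d [Vb Vd e]]]; exists b, (d + c * b); split=> //.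
    by apply: (VD) => //; exact: VM.
  by rewrite mulrDl addrA -e; ring.
have iP : submodule V (nonunits V).
  split.
  - split; first by rewrite -(subrr 1); exact: VB.
    move=> u0; apply: (unit_mod_t vV).
    apply: (Usub _ 1) => //; by rewrite mul1r subrr.
  - move=> x y [Vx nx] [Vy ny]; split; [exact: VD|move=> [b [c [Vb Vc e]]]].
    have Vxb := VM _ _ Vx Vb; have Vyb := VM _ _ Vy Vb.
    have [|] := unit_mod_split vV Vxb.
      by case/(unit_modM vV Vx Vb).
    have -> : 1 - x * b = y * b - c * tq.
      by rewrite -[X in X - x * b](addrK (c * tq)) -e; ring.
    by move/(Usub _ _ Vyb Vc) => /(unit_modM vV Vy Vb)[].
  - move=> a x Va [Vx nx]; split; first exact: VM.
    by case/(unit_modM vV Va Vx).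
split; last by exists tq; split=> //; exact: to_frac_regular.
split; first by split=> // x [].
  move=> e; have [_] : nonunits V 1 by rewrite e.
  apply; exists 1, 0; split=> //; last by ring.
  by rewrite -(subrr 1); exact: VB.
move=> I [IV [I0 ID IM]] PI.
have [IP|] := pselect (I `<=` nonunits V); first by left; apply/seteqP.
move=> /existsNP[x /not_implyP[Ix nPx]]; right; apply/seteqP; split=> // y Vy.
have Vx := IV _ Ix.
have [b [c [Vb Vc e]]] : unit_mod V x by apply: contrapT => nx; apply: nPx.
have -> : y = y * b * x + (- (y * c)) * tq.
  by rewrite -mulrA [b * x]mulrC e; ring.
apply: (ID); apply: (IM); rewrite //; [exact: VM| |exact: PI].
by rewrite -sub0r; apply: (VB); [rewrite -(subrr 1); exact: VB|exact: VM].
Qed.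

Lemma regular_maximalE V M : valuation_rings A V -> regular_maximal V M -> M = nonunits V.
Proof.
move=> vV hM; have M1 := regular_maximal_not1 vV hM.
have [[[MV [M0 MD MM]] MnV Mmax] [r [Mr rr]]] := hM.
have [PV _] := nonunits_regular_maximal vV; have [iP PnV _] := PV.
have VM u w := @valuation_ringsM V u w vV; have V1 := valuation_rings1 vV.
have V0 : V 0 by rewrite -(subrr 1); exact: valuation_ringsB.
have VN x : V x -> V (- x) by move=> Vx; rewrite -sub0r; exact: valuation_ringsB.
have [k Mtk] : exists k, M (tq ^+ k).
  apply: submodule_denom Mr rr; apply: submoduleW (And3 M0 MD MM) => _ [a _ <-].
  exact: valuation_rings_base.
suff MP : M `<=` nonunits V.
  by have [//|e] := Mmax _ iP MP; case: PnV.
move=> x Mx; split; first exact: MV.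
move=> [b [c [Vb Vc e]]]; apply: M1.
(* An element of M that is a unit modulo t yields elements of M congruent to 1 modulo higher and
   higher powers of t, starting from 0 = 1 - t^0. At the power t^k contained in M this gives 1 in
   M. *)
have MX n : exists d, V d /\ M (1 + d * tq ^+ n).
  elim: n => [|n [d [Vd Md]]].
    by exists (-1); split; [exact: VN|rewrite expr0 mulr1 subrr].
  exists (- (d * c)); split; first exact/VN/VM.
  have -> : 1 + - (d * c) * tq ^+ n.+1 = (1 + d * tq ^+ n) + (- (d * tq ^+ n) * b) * x.
    by rewrite -[_ * b * x]mulrA [b * x]mulrC e exprS; ring.
  apply: (MD) => //; apply: (MM) => //; apply: (VM) => //; apply: (VN); apply: (VM) => //.
  by rewrite /tq -rmorphXn; exact: valuation_rings_base.
have [d [Vd Md]] := MX k.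
have -> : 1 = (1 + d * tq ^+ k) + (- d) * tq ^+ k by ring.
by apply: (MD) => //; apply: (MM) => //; exact: VN.
Qed.

Lemma max_ofE V : valuation_rings A V -> max_of V = nonunits V.
Proof.
move=> vV; apply: regular_maximalE => //.
exact: (@xgetPex _ set0 [set M | regular_maximal V M]
  (ex_intro _ _ (nonunits_regular_maximal vV))).
Qed.

End ValuationRings.

(* f : A -> B is an isomorphism modulo t, with t a regular element whose powers
   are divisible by every regular element of A, and likewise for f t in B. *)
Section AnalyticIsomorphism.
Variables (A B : comPzRingType) (f : {rmorphism A -> B}) (t : A).
Hypothesis rt : regular t.
Hypothesis rft : regular (f t).
Hypothesis dvdt : forall r : A, regular r -> exists k, principal r (t ^+ k).
Hypothesis dvdft : forall r : B, regular r -> exists k, principal r (f t ^+ k).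
Hypothesis f_inj : injective f.
Hypothesis f_split : forall x, exists a w, x = f a + w * f t.
Hypothesis f_principal : forall a, principal (f t) (f a) -> principal t a.
Hypothesis f_unit : forall w, exists v, (1 + w * f t) * v = 1.

Lemma f_regular s : regular s -> regular (f s).
Proof.
move=> /dvdt[k [b e]]; apply: (@regular_dvd _ _ (f b) (f t ^+ k)).
  exact: regularX.
by rewrite -rmorphXn e rmorphM mulrC.
Qed.

Variable i : {rmorphism total_frac A -> total_frac B}.
Hypothesis iE : forall a, i (to_frac A a) = to_frac B (f a).

Let tq : total_frac A := to_frac A t.
Let tb : total_frac B := to_frac B (f t).

Let ext := extend f.
Let extE := extendE f_regular iE.

Lemma i_t : i tq = tb.
Proof. exact: iE. Qed.

Lemma f_splitX n x : exists a w, x = f a + w * f t ^+ n.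
Proof.
elim: n => [|n [a [w ->]]].
  by exists 0, x; rewrite rmorph0 add0r mulr1.
have [b [v ->]] := f_split w; exists (a + b * t ^+ n), v.
by rewrite rmorphD rmorphM rmorphXn exprS; ring.
Qed.

Lemma f_principalX n a : principal (f t ^+ n) (f a) -> principal (t ^+ n) a.
Proof.
elim: n a => [|n IH] a [w e]; first by exists a; rewrite mulr1.
have [b eb] : principal t a.
  by apply: f_principal; exists (w * f t ^+ n); rewrite e exprSr mulrA.
have [|c ec] := IH b; last by exists c; rewrite eb ec exprSr mulrA.
exists w; apply: (regular_inj rft).
by rewrite mulrC -rmorphM -eb e exprS; ring.
Qed.

Lemma i_inj : injective i.
Proof.
apply: raddf_inj => x ix; have [a [s [rs e]]] := fracP x.
apply: (to_frac_regular rs); rewrite mulrC e.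
have /to_frac_inj/f_inj -> : to_frac B (f a) = to_frac B (f 0).
  by rewrite -iE -e rmorphM ix mul0r !rmorph0.
exact: rmorph0.
Qed.

Lemma i_principal n x w : i x = to_frac B w * tb ^+ n ->
  exists a, x = to_frac A a * tq ^+ n.
Proof.
move=> e; have [k [a ea]] := frac_denom dvdt x.
have [v tv] := to_frac_unit rt.
have [|b eb] := @f_principalX (n + k) a.
  exists w; apply: to_frac_inj; rewrite -iE -ea !rmorphM e !rmorphXn /= iE -/tb exprD; ring.
exists b; rewrite -[x]mulr1 -(unitX k tv) mulrA ea eb rmorphM rmorphXn exprD -/tq.
transitivity (to_frac A b * tq ^+ n * (tq ^+ k * v ^+ k)); first by ring.
by rewrite unitX // mulr1.
Qed.

Lemma i_splitX n y : exists x w, y = i x + to_frac B w * tb ^+ n.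
Proof.
have [k [b e]] := frac_denom dvdft y; have [v tv] := to_frac_unit rt.
have [a [w eb]] := f_splitX (n + k) b.
exists (to_frac A a * v ^+ k), w.
have iv : tb ^+ k * i v ^+ k = 1.
  by apply: unitX; rewrite -i_t -rmorphM tv rmorph1.
have -> : y = to_frac B b * i v ^+ k by rewrite -e -/tb -mulrA iv mulr1.
rewrite eb rmorphM rmorphXn iE rmorphD rmorphM rmorphXn -/tb exprD mulrDl; congr (_ + _).
transitivity (to_frac B w * tb ^+ n * (tb ^+ k * i v ^+ k)); first by ring.
by rewrite iv mulr1.
Qed.

Lemma ext_i E x : E x -> ext E (i x).
Proof.
move=> Ex; rewrite /ext extE -(mul1r (i x)); apply: prod_ideal_sub; last by exists x.
by rewrite -(rmorph1 (to_frac B)); exact: to_frac_ring.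
Qed.

Lemma ext_submodule E : submodule (@ring_in_frac B) (ext E).
Proof. by rewrite /ext extE; apply: prod_ideal_submodule_l; exact: ring_in_frac_submodule. Qed.

Lemma ext_ind E (F : set (total_frac B)) : submodule (@ring_in_frac B) F ->
  (forall x, E x -> F (i x)) -> ext E `<=` F.
Proof.
move=> [F0 FD FM] EF; rewrite /ext extE; apply: prod_ideal_ind => //.
by move=> b _ Bb [x Ex <-]; apply: FM => //; exact: EF.
Qed.

(** E is t-adically dense in its extension: with t^k clearing the denominator of x, the coefficient
    b of x is approximated by an element of A up to t^(n+k). *)
Lemma extP n E y : submodule (@ring_in_frac A) E -> ext E y ->
  exists x w, E x /\ y = i x + to_frac B w * tb ^+ n.
Proof.
move=> [E0 ED EM]; rewrite /ext extE; move: y; apply: prod_ideal_ind.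
- by exists 0, 0; split=> //; rewrite !rmorph0 mul0r addr0.
- move=> _ _ [x [w [Ex ->]]] [x' [w' [Ex' ->]]]; exists (x + x'), (w + w').
  by split; [exact: ED|rewrite !rmorphD; ring].
move=> _ _ [b _ <-] [x Ex <-]; have [k [a ea]] := frac_denom dvdt x.
have [c [w ->]] := f_splitX (n + k) b; exists (to_frac A c * x), (w * f a).
split; first by apply: EM => //; exact: to_frac_ring.
have ifa : to_frac B (f a) = i x * tb ^+ k by rewrite -iE -ea rmorphM rmorphXn i_t.
by rewrite rmorphD !rmorphM rmorphXn iE ifa -/tb exprD; ring.
Qed.

(** Openness in the u-adic topology. An approximation with error in u^n T then stays within E, which
    makes extension and contraction inverse to each other on such submodules. *)
Definition t_open (T : comPzRingType) (u : T) (E : set (total_frac T)) : Prop :=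
  submodule (@ring_in_frac T) E /\ exists n, E (to_frac T u ^+ n).

Lemma ext_contract E x : t_open t E -> ext E (i x) <-> E x.
Proof.
move=> [mE [n En]]; split; last exact: ext_i.
have [E0 ED EM] := mE => /(extP n mE)[y [w [Ey e]]].
have [|a ea] := @i_principal n (x - y) w; first by rewrite rmorphB e addrAC subrr add0r.
rewrite -(subrK y x) ea; apply: ED => //; apply: EM => //; exact: to_frac_ring.
Qed.

Lemma ext_open E : t_open t E -> t_open (f t) (ext E).
Proof.
move=> [mE [n En]]; split; first exact: ext_submodule.
by exists n; rewrite -/tb -i_t -rmorphXn; exact: ext_i.
Qed.

Lemma preimage_open F : t_open (f t) F -> t_open t (i @^-1` F).
Proof.
move=> [[F0 FD FM] [n Fn]]; split; last by exists n; rewrite /= rmorphXn i_t.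
split=> [|x y Fx Fy|_ x [a _ <-] Fx] /=; first by rewrite rmorph0.
  by rewrite rmorphD; exact: FD.
by rewrite rmorphM iE; apply: FM => //; exact: to_frac_ring.
Qed.

Lemma ext_preimage F : t_open (f t) F -> ext (i @^-1` F) = F.
Proof.
move=> oF; have [mF [n Fn]] := oF; have [F0 FD FM] := mF.
have [_ F'D F'M] := ext_submodule (i @^-1` F).
apply/seteqP; split; first exact: ext_ind.
move=> y Fy; have [x [w e]] := i_splitX n y.
have Fw : F (to_frac B w * tb ^+ n) by apply: FM => //; exact: to_frac_ring.
rewrite e; apply: F'D.
  apply: ext_i; rewrite /= -(addrK (to_frac B w * tb ^+ n) (i x)) -e.
  by apply: submoduleB mF Fy Fw; exists (-1); rewrite // rmorphN rmorph1.
apply: F'M; first exact: to_frac_ring.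
by rewrite -i_t -rmorphXn; apply: ext_i; rewrite /= rmorphXn i_t.
Qed.

Lemma ext_prod I J : prod_ideal (ext I) (ext J) = ext (prod_ideal I J).
Proof.
have mB := ring_in_frac_submodule B; have [B0 BD BM] := mB.
have mIJ : submodule (@ring_in_frac B) (prod_ideal (ext I) (ext J)).
  by apply: prod_ideal_submodule; exact: ext_submodule.
have [IJ0 IJD IJM] := mIJ; have [E0 ED EM] := ext_submodule (prod_ideal I J).
apply/seteqP; split; last first.
  apply: ext_ind => // x; move: x.
  apply: (@prod_ideal_ind _ _ _ [set x | prod_ideal (ext I) (ext J) (i x)]).
  - by rewrite /= rmorph0.
  - by move=> x y; rewrite /= rmorphD; exact: IJD.
  by move=> x y Ix Jy; rewrite /= rmorphM; apply: prod_ideal_sub; exact: ext_i.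
apply: prod_ideal_ind => // x y Ix Jy; move: x Ix.
apply: (ext_ind (F := [set x | ext (prod_ideal I J) (x * y)])).
  split=> [|u v|b u Bb]; rewrite /=; first by rewrite mul0r.
    by rewrite mulrDl; exact: ED.
  by rewrite -mulrA; exact: EM.
move=> x Ix /=; move: y Jy.
apply: (ext_ind (F := [set y | ext (prod_ideal I J) (i x * y)])).
  split=> [|u v|b u Bb]; rewrite /=; first by rewrite mulr0.
    by rewrite mulrDr; exact: ED.
  by rewrite mulrCA; exact: EM.
by move=> y Jy /=; rewrite -rmorphM; apply: ext_i; exact: prod_ideal_sub.
Qed.

(** * Valuation rings and regular maximal ideals under extension *)

Lemma valuation_rings_open (T : comPzRingType) (u : T) V : valuation_rings T V -> t_open u V.
Proof.
move=> vV; split; last by exists 0%N; exact: valuation_rings1.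
apply: submoduleW (valuation_rings_submodule vV) => _ [a _ <-].
exact: valuation_rings_base.
Qed.

Lemma ext_valuation_rings V : valuation_rings A V -> valuation_rings B (ext V).
Proof.
move=> vV; have oV := valuation_rings_open t vV.
have mE := ext_submodule V; have [E0 ED EM] := mE.
have E1 : ext V 1 by rewrite -(rmorph1 i); apply: ext_i; exact: valuation_rings1.
have BE : @ring_in_frac B `<=` ext V by move=> b Bb; rewrite -(mulr1 b); exact: EM.
have EMM x y : ext V x -> ext V y -> ext V (x * y).
  move=> Ex Ey; have : prod_ideal (ext V) (ext V) (x * y) by exact: prod_ideal_sub.
  rewrite ext_prod; apply: ext_ind => // z Vz; apply: ext_i; move: z Vz.
  apply: prod_ideal_ind => [|z w|z w].
  - by have [] := valuation_rings_submodule vV.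
  - exact: valuation_ringsD.
  - exact: valuation_ringsM.
split=> //.
- split=> [|x y /set_mem Ex /set_mem Ey|x y /set_mem Ex /set_mem Ey]; apply/mem_set => //.
    by apply: submoduleB mE Ex Ey; exists (-1); rewrite // rmorphN rmorph1.
  exact: EMM.
- move=> e; have [x nVx] := valuation_rings_neqT vV; apply: nVx.
  by apply/(ext_contract _ oV); rewrite e.
move=> x y nx ny xy.
(* The precisions are chosen in turn: t^k clears the denominator of y and bounds the error of x0,
   then t^l clears the denominator of x0 and bounds the error of y0. Thus x0 y0 differs from x y by
   an element of B. *)
have [k [b eb]] := frac_denom dvdft y.
have [x0 [w ex]] := i_splitX k x.
have [l [a ea]] := frac_denom dvdt x0.
have [y0 [w' ey]] := i_splitX l y.
have Bwt z n u : z * tb ^+ n = to_frac B u -> forall w, ext V (to_frac B w * tb ^+ n * z).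
  move=> e w0; have -> : to_frac B w0 * tb ^+ n * z = to_frac B (w0 * u).
    by rewrite rmorphM -e; ring.
  by apply: BE; exact: to_frac_ring.
have Bt w0 n : ext V (to_frac B w0 * tb ^+ n).
  by apply: BE; rewrite /tb -rmorphXn -rmorphM; exact: to_frac_ring.
have EN z : ext V z -> ext V (- z).
  by move=> Ez; rewrite -sub0r; apply: submoduleB mE E0 Ez; exists (-1); rewrite // rmorphN rmorph1.
have nx0 : ~ V x0.
  by move=> Vx0; apply: nx; rewrite ex; apply: ED => //; exact: ext_i.
have ny0 : ~ V y0.
  by move=> Vy0; apply: ny; rewrite ey; apply: ED => //; exact: ext_i.
have [|/nx0|/ny0] // := @valuation_rings_mul _ V x0 y0 vV.
apply/(ext_contract _ oV); rewrite rmorphM.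
have -> : i x0 * i y0 = x * y + - (to_frac B w * tb ^+ k * y) + - (to_frac B w' * tb ^+ l * i x0).
  by rewrite ey ex; ring.
have ei : i x0 * tb ^+ l = to_frac B (f a) by rewrite -iE -ea rmorphM rmorphXn i_t.
by apply: (ED); [apply: (ED)|]; rewrite //; apply: EN; [exact: Bwt eb w|exact: Bwt ei w'].
Qed.

Lemma preimage_valuation_rings W : valuation_rings B W -> valuation_rings A (i @^-1` W).
Proof.
move=> vW; have oW := valuation_rings_open (f t) vW; split.
- split=> [|x y /set_mem Wx /set_mem Wy|x y /set_mem Wx /set_mem Wy]; apply/mem_set => /=.
  + by rewrite rmorph1; exact: valuation_rings1.
  + by rewrite rmorphB; exact: valuation_ringsB.
  + by rewrite rmorphM; exact: valuation_ringsM.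
- by move=> _ [a _ <-]; rewrite /= iE; exact: valuation_rings_base.
- move=> e; have [y nWy] := valuation_rings_neqT vW; apply: nWy.
  have [x [w ->]] := i_splitX 0 y; apply: valuation_ringsD => //.
    by have : (i @^-1` W) x by rewrite e.
  by rewrite expr0 mulr1; exact: valuation_rings_base.
by move=> x y nx ny; rewrite /= rmorphM => /(valuation_rings_mul vW)[].
Qed.

Lemma regular_maximal_open (T : comPzRingType) (u : T) V M :
  (forall r : T, regular r -> exists k, principal r (u ^+ k)) ->
  valuation_rings T V -> regular_maximal V M -> t_open u M.
Proof.
move=> dvdu vV [[[_ mM] _ _] [x [Mx rx]]].
have mM' : submodule (@ring_in_frac T) M.
  by apply: submoduleW mM => _ [a _ <-]; exact: valuation_rings_base.
by split=> //; exact: (submodule_denom dvdu mM' Mx rx).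
Qed.

Lemma ext_regular_maximal V M : valuation_rings A V -> regular_maximal V M ->
  regular_maximal (ext V) (ext M).
Proof.
move=> vV hM; have vW := ext_valuation_rings vV.
have oV := valuation_rings_open t vV; have oM := regular_maximal_open dvdt vV hM.
have M1 := regular_maximal_not1 vV hM; have [[[MV mM] _ Mmax] _] := hM.
have sub E F : E `<=` F -> ext E `<=` ext F.
  by move=> EF; apply: ext_ind; [exact: ext_submodule|move=> x /EF; exact: ext_i].
have extM : submodule (ext V) (ext M).
  have [_ _ MM] := mM; have [M0 MD _] := ext_submodule M; split=> // a x Va Mx.
  have : prod_ideal (ext V) (ext M) (a * x) by exact: prod_ideal_sub.
  rewrite ext_prod; apply: sub; apply: prod_ideal_ind => //; by case: mM.
split; last first.
  have [_ [n Mn]] := oM; exists (i (tq ^+ n)); split; first exact: ext_i.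
  by rewrite rmorphXn i_t; apply: regularX; exact: to_frac_regular.
split; first by split; first exact: sub.
  move=> e; apply: M1; apply/(ext_contract _ oM); rewrite e rmorph1.
  exact: valuation_rings1.
move=> I [IW mI] MI.
have oI : t_open (f t) I.
  split; last by have [_ [n Mn]] := ext_open oM; exists n; exact: MI.
  by apply: submoduleW mI => _ [b _ <-]; exact: valuation_rings_base.
rewrite -(ext_preimage oI); have [||->|->] := Mmax (i @^-1` I); [| |by left|by right].
  split; first by move=> x /IW /(ext_contract _ oV).
  have [I0 ID IM] := mI.
  split=> [|x y Ix Iy|a x Va Ix] /=; rewrite ?rmorph0 ?rmorphD ?rmorphM //.
    exact: ID.
  by apply: IM => //; exact: ext_i.
by move=> x Mx; apply: MI; exact: ext_i.
Qed.

Lemma preimage_regular_maximal V M : valuation_rings A V -> regular_maximal (ext V) M ->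
  regular_maximal V (i @^-1` M).
Proof.
move=> vV hM; have vW := ext_valuation_rings vV.
have oV := valuation_rings_open t vV; have oM := regular_maximal_open dvdft vW hM.
have M1 := regular_maximal_not1 vW hM; have [[[MW [M0 MD MM]] _ Mmax] _] := hM.
split; last first.
  have [_ [n Mn]] := preimage_open oM; exists (tq ^+ n); split=> //.
  by apply: regularX; exact: to_frac_regular.
split.
- split; first by move=> x /MW /(ext_contract _ oV).
  split=> [|x y Mx My|a x Va Mx] /=; rewrite ?rmorph0 ?rmorphD ?rmorphM //.
    exact: MD.
  by apply: MM => //; exact: ext_i.
- move=> e; apply: M1; rewrite -(rmorph1 i).
  have : V 1 by exact: valuation_rings1.
  by rewrite -e.
move=> I [IV mI] MI.
have oI : t_open t I.
  split; last by have [_ [n Mn]] := preimage_open oM; exists n; exact: MI.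
  by apply: submoduleW mI => _ [b _ <-]; exact: valuation_rings_base.
have extI : submodule (ext V) (ext I).
  have [_ _ IM] := mI; have [I0 ID _] := ext_submodule I; split=> // a x Va Ix.
  have : prod_ideal (ext V) (ext I) (a * x) by exact: prod_ideal_sub.
  rewrite ext_prod; apply: ext_ind; first exact: ext_submodule.
  move=> z; move: z; apply: (@prod_ideal_ind _ _ _ [set z | ext I (i z)]).
  - by rewrite /= rmorph0.
  - by move=> u v; rewrite /= rmorphD; exact: ID.
  by move=> u v Vu Iv /=; apply: ext_i; exact: IM.
have IE : I = i @^-1` (ext I).
  by apply/seteqP; split=> x; [exact: ext_i|move/(ext_contract _ oI)].
have [||e|e] := Mmax (ext I).
- by split=> //; apply: ext_ind => [|x /IV]; [exact: ext_submodule|exact: ext_i].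
- by rewrite -(ext_preimage oM); apply: ext_ind => [|x /MI]; [exact: ext_submodule|exact: ext_i].
- by left; rewrite IE e.
by right; rewrite IE e; apply/seteqP; split=> x; [move/(ext_contract _ oV)|exact: ext_i].
Qed.

(** * Powers of the maximal ideal, values and value sets *)

Hypothesis von_neumann : forall x : total_frac A, exists y, x * x * y = x.

Lemma max_of_regular_maximal V : valuation_rings A V -> regular_maximal V (max_of V).
Proof.
by move=> vV; rewrite (max_ofE rt dvdt) //; exact: (nonunits_regular_maximal rt dvdt).
Qed.

Lemma max_of_open V : valuation_rings A V -> t_open t (max_of V).
Proof.
by move=> vV; exact: regular_maximal_open dvdt vV (max_of_regular_maximal vV).
Qed.

(** Any regular maximal ideal of the extension is extended from its contraction, which is a regular
    maximal ideal of V and so the unique one. Uniqueness is thereby inherited from A. *)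
Lemma max_of_ext V : valuation_rings A V -> max_of (ext V) = ext (max_of V).
Proof.
move=> vV; have vW := ext_valuation_rings vV.
have hW : regular_maximal (ext V) (max_of (ext V)).
  exact: (@xgetPex _ set0 [set M | regular_maximal (ext V) M] (ex_intro _ _
    (ext_regular_maximal vV (max_of_regular_maximal vV)))).
rewrite -(ext_preimage (regular_maximal_open dvdft vW hW)); congr ext.
rewrite (max_ofE rt dvdt) //.
by apply: (regular_maximalE rt dvdt) => //; exact: preimage_regular_maximal.
Qed.

Lemma power_ext V n : valuation_rings A V ->
  power (ext V) (max_of (ext V)) n = ext (power V (max_of V) n).
Proof.
move=> vV; elim: n => // n IH.
by rewrite /power !iterS -!/(power _ _ _) IH max_of_ext // ext_prod.
Qed.

Lemma power_open V n : valuation_rings A V -> t_open t (power V (max_of V) n).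
Proof.
move=> vV; have [_ [k Pk]] := max_of_open vV; split.
  apply: (@submoduleW _ _ V); last by apply: power_submodule; exact: valuation_rings_submodule.
  by move=> _ [a _ <-]; exact: valuation_rings_base.
by exists (k * n)%N; rewrite exprM; apply: power_exp => //; exact: valuation_rings1.
Qed.

Lemma max_power_ext V k x : valuation_rings A V ->
  max_power (ext V) k (i x) <-> max_power V k x.
Proof.
move=> vV; have oV := valuation_rings_open t vV; case: k => n.
  by rewrite /max_power power_ext //; apply: ext_contract; exact: power_open.
rewrite /max_power power_ext //; split=> h y.
  by move=> Py; apply/(ext_contract _ oV); rewrite rmorphM; apply: h; exact: ext_i.
have [E0 ED EM] := ext_submodule V; move: y.
apply: (ext_ind (F := [set y | ext V (i x * y)])).
  split=> [|u v|b u Bb]; rewrite /=; first by rewrite mulr0.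
    by rewrite mulrDr; exact: ED.
  by rewrite mulrCA; exact: EM.
by move=> y Py; rewrite /= -rmorphM; apply: ext_i; exact: h.
Qed.

(** [nu] sees only the set of exponents k with x in the k-th power, so the two [xget] values
    coincide even where the default applies. *)
Lemma nu_eq (T T' : comPzRingType) (V : set (total_frac T)) (V' : set (total_frac T')) x x' :
  (forall k, max_power V k x <-> max_power V' k x') -> nu V x = nu V' x'.
Proof.
move=> h; rewrite /nu.
have -> : `[< forall k, max_power V k x >] = `[< forall k, max_power V' k x' >].
  by apply: asbool_equiv_eq; split=> hx k; apply/h.
congr (if _ then _ else Some (xget _ _)); apply/seteqP.
by split=> k [/h hk kmax]; split=> // l /h; exact: kmax.
Qed.

Lemma nu_ext V x : valuation_rings A V -> nu (ext V) (i x) = nu V x.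
Proof. by move=> vV; apply: nu_eq => k; exact: max_power_ext. Qed.

Lemma max_powerM (T : comPzRingType) (V : set (total_frac T)) k a x :
  valuation_rings T V -> max_power V k x -> max_power V k (to_frac T a * x).
Proof.
move=> vV; have Va := valuation_rings_base a vV; case: k => n.
  have [_ _] := power_submodule (max_of V) n (valuation_rings_submodule vV).
  by apply.
by move=> h y Py; rewrite -mulrA; apply: valuation_ringsM => //; exact: h.
Qed.

Lemma nu_unit (T : comPzRingType) (V : set (total_frac T)) u v x :
  valuation_rings T V -> u * v = 1 -> nu V (to_frac T u * x) = nu V x.
Proof.
move=> vV uv; apply: nu_eq => k; split; last exact: max_powerM.
move/(max_powerM v vV); rewrite mulrA -rmorphM mulrC [v * u]mulrC uv.
by rewrite rmorph1 mulr1.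
Qed.

Lemma Gamma_ext (phi : valuation_rings A -> valuation_rings B) E :
  bijective phi -> (forall V, sval (phi V) = ext (sval V)) ->
  submodule (@ring_in_frac A) E ->
  Gamma E = [set (beta \o phi)%FUN | beta in Gamma (ext E)].
Proof.
move=> [psi phiK psiK] phiE mE.
have vV (V : valuation_rings A) : valuation_rings A (sval V) := set_mem (svalP V).
apply/seteqP; split=> [alpha [x [Ex rx nux]]|_ [beta [y [Ey ry nuy]] <-]].
  exists (alpha \o psi); last by apply/funext => V /=; rewrite phiK.
  exists (i x); split; first exact: ext_i.
    have [y xy] := frac_unit rx; apply: (@regular_unit _ _ (i y)).
    by rewrite -rmorphM xy rmorph1.
  by move=> W; rewrite -[in LHS](psiK W) phiE nu_ext // nux.
(* With z inverse to y and c = t^k z in B, precision k + 1 leaves a spare factor t: the error w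
   t^(k+1) equals w c t y, so that x = (1 - w c t) y with a unit in front. *)
have [z yz] := frac_unit ry; have [k [c ec]] := frac_denom dvdft z.
have [x [w [Ex ey]]] := extP k.+1 mE Ey.
have [v uv] := f_unit (- (w * c)).
set u := 1 + - (w * c) * f t in uv.
have ix : i x = to_frac B u * y.
  have -> : i x = y - to_frac B w * tb ^+ k.+1 * (y * z) by rewrite yz ey; ring.
  rewrite /u rmorphD rmorph1 !rmorphM rmorphN rmorphM -ec -/tb exprS; ring.
exists x; split=> //.
  move=> q xq; apply: i_inj; rewrite rmorph0; apply: (@regular_unit _ (i x) (to_frac B v * z)).
    rewrite ix; transitivity (to_frac B (u * v) * (y * z)); first by rewrite rmorphM; ring.
    by rewrite uv yz rmorph1 mulr1.
  by rewrite -rmorphM xq rmorph0.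
move=> V; rewrite /= -(nuy (phi V)) phiE -nu_ext // ix; apply: nu_unit uv.
exact: ext_valuation_rings.
Qed.

Lemma ex_phi : exists phi : valuation_rings A -> valuation_rings B,
  bijective phi /\ forall V, sval (phi V) = ext (sval V).
Proof.
have vV (T : comPzRingType) (V : valuation_rings T) : valuation_rings T (sval V) :=
  set_mem (svalP V).
pose phi (V : valuation_rings A) : valuation_rings B :=
  exist _ (ext (sval V)) (mem_set (ext_valuation_rings (vV _ V))).
pose psi (W : valuation_rings B) : valuation_rings A :=
  exist _ (i @^-1` sval W) (mem_set (preimage_valuation_rings (vV _ W))).
exists phi; split=> //; exists psi => V; apply: val_inj => /=.
  apply/seteqP; split=> x /=.
    by move/(ext_contract _ (valuation_rings_open t (vV _ V))).
  exact: ext_i.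
by apply: ext_preimage; exact: (valuation_rings_open (f t) (vV _ V)).
Qed.

(** * Centers of valuation rings and of their extensions *)

Lemma center_t V : valuation_rings A V -> center V t.
Proof.
move=> vV; rewrite /center /= (max_ofE rt dvdt) //; split; first exact: valuation_rings_base.
exact: (unit_mod_t rt dvdt).
Qed.

Lemma center_prime V : valuation_rings A V -> prime_ideal (center V).
Proof.
move=> vV; have hP := max_of_regular_maximal vV.
have [[[_ [P0 PD PM]] _ _] _] := hP; split.
- apply/idealE; split; rewrite /center /=; first by rewrite rmorph0.
    by move=> x y; rewrite /= rmorphD; exact: PD.
  by move=> a x _; rewrite /= rmorphM; apply: PM; exact: valuation_rings_base.
- by rewrite /center /= rmorph1; exact: regular_maximal_not1 hP.
move=> x y; rewrite /center /= rmorphM (max_ofE rt dvdt) // => -[_ nxy].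
have Vx := valuation_rings_base x vV; have Vy := valuation_rings_base y vV.
have [ux|nx] := pselect (unit_mod t V (to_frac A x)); last by left.
have [uy|ny] := pselect (unit_mod t V (to_frac A y)); last by right.
by case: nxy; apply/unit_modM.
Qed.

Lemma center_ext V a w : valuation_rings A V ->
  center (ext V) (f a + w * f t) <-> center V a.
Proof.
move=> vV; rewrite /center /= max_of_ext // rmorphD rmorphM -iE.
have oP := max_of_open vV; rewrite -[X in _ <-> X](ext_contract _ oP).
have mP := ext_submodule (max_of V); have [_ PD PM] := mP.
have Pt : ext (max_of V) (to_frac B w * to_frac B (f t)).
  by apply: PM; [exact: to_frac_ring|rewrite -iE; apply: ext_i; exact: center_t].
split=> [P1|P1]; last exact: PD.
rewrite -(addrK (to_frac B w * to_frac B (f t)) (i _)).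
by apply: submoduleB mP P1 Pt; exists (-1); rewrite // rmorphN rmorph1.
Qed.

(** By [center_ext], membership of f a + w f t depends on a alone, so primality is checked on the
    components in A. *)
Lemma center_ext_prime V : valuation_rings A V -> prime_ideal (center (ext V)).
Proof.
move=> vV; have [iP P1 PM] := center_prime vV; have [_ [Q0 QD QM]] := iP.
split.
- apply/idealE; split.
  + have -> : 0 = f 0 + 0 * f t by rewrite rmorph0; ring.
    exact/center_ext.
  + move=> x y; have [a [w ->]] := f_split x; have [b [v ->]] := f_split y.
    have -> : f a + w * f t + (f b + v * f t) = f (a + b) + (w + v) * f t by rewrite rmorphD; ring.
    move=> /center_ext ca /center_ext cb.
    by apply/center_ext => //; apply: QD; [exact: ca|exact: cb].
  + move=> x y _; have [a [w ->]] := f_split x; have [b [v ->]] := f_split y.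
    have -> : (f a + w * f t) * (f b + v * f t) =
      f (a * b) + (w * f b + (f a + w * f t) * v) * f t by rewrite rmorphM; ring.
    by move=> /center_ext cb; apply/center_ext => //; apply: QM => //; exact: cb.
- have -> : 1 = f 1 + 0 * f t by rewrite rmorph1; ring.
  by move=> /center_ext c1; apply: P1; exact: c1.
move=> x y; have [a [w ->]] := f_split x; have [b [v ->]] := f_split y.
have -> : (f a + w * f t) * (f b + v * f t) =
  f (a * b) + (w * f b + (f a + w * f t) * v) * f t by rewrite rmorphM; ring.
by move=> /center_ext cab; have [|ca|cb] := PM a b; [exact: cab|left|right]; exact/center_ext.
Qed.

End AnalyticIsomorphism.

Lemma hat_principalX (A : comPzRingType) (t : A) K n a : regular t -> jacobson t ->
  jpower K `<=` principal t ->
  principal (to_hat A t ^+ n) (to_hat A a) -> principal (t ^+ n) a.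
Proof.
move=> rt Jt JK.
exact: (f_principalX (hat_regular rt Jt JK) (hat_principal JK)).
Qed.

Lemma telescope (A B : comPzRingType) (h : {rmorphism A -> B}) (t : A) (r : nat -> A)
    (z : nat -> B) : (forall n, z n = h (r n) + z n.+1 * h t) ->
  forall n, z 0%N = h (\sum_(i < n) r i * t ^+ i) + z n * h t ^+ n.
Proof.
move=> zP; elim=> [|n ->]; first by rewrite big_ord0 rmorph0 expr0; ring.
by rewrite big_ord_recr rmorphD rmorphM rmorphXn /= zP exprS; ring.
Qed.

(** * The completion of the localization at a maximal ideal *)

Section LocalCompletion.
Variables (R : comPzRingType) (t : R) (K : nat).
Hypothesis rt : regular t.
Hypothesis Jt : jacobson t.
Hypothesis JK : jpower K `<=` principal t.
Hypothesis dvdt : forall r : R, regular r -> exists k, principal r (t ^+ k).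
Hypothesis regular_add : forall a : R, exists y, a * y = 0 /\ regular (a + y).
Hypothesis unitJ : forall a : R, jacobson a -> exists b, (1 + a) * b = 1.

Variables (m : set R) (e : R).
Hypothesis maxm : Max R m.
Hypothesis idem_e : principal t (e * e - e).
Hypothesis m1e : m (1 - e).
Hypothesis e_exp : forall v, ~ m v -> exists k b c, e ^+ k = b * v + c * t.

Let A := local_at m.
Let loc_m : {rmorphism R -> A} := to_local m.
Let u : A := loc_m t.
Let th : hat R := to_hat R t.
Let uh : hat A := to_hat A u.

Let pm : prime_ideal m := maximal_prime maxm.
Let im : ideal m := maximal_ideal maxm.

Lemma local_regular : regular u.
Proof. exact: to_local_regular. Qed.

Lemma local_jacobson_t : jacobson u.
Proof. by rewrite local_jacobson //; apply: to_local_max => //; exact: Jt. Qed.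

Lemma notin_e : ~ m e.
Proof.
move=> me; apply: (maximal_not1 maxm).
by rewrite -(subrK e 1); exact: idealD.
Qed.

(** [e] lies in every maximal ideal M other than m: choosing v in M outside m, a power of e is b v +
    c t, which is in M. *)
Lemma jacobson_e a : m a -> jacobson (e * a).
Proof.
move=> ma M mM; have [->|Mm] := pselect (M = m); first exact: idealMr.
have [v Mv mv] : exists2 v, M v & ~ m v.
  apply: contrapT => nov; apply: Mm; apply/esym/(maximal_eq mM) => //.
    exact: maximal_not1.
  by move=> v Mv; apply: contrapT => mv; apply: nov; exists v.
have [k [b [c ek]]] := e_exp mv.
apply: idealMl; first exact: maximal_ideal.
apply: (@prime_exp _ _ _ k); first exact: maximal_prime.
rewrite ek; have iM := maximal_ideal mM.
by apply: idealD => //; apply: idealMr => //; exact: Jt.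
Qed.

Lemma local_jpower n x : jpower n x ->
  exists s r, [/\ ~ m s, jpower n r & x * loc_m s = loc_m r].
Proof.
elim: n x => [|n IH] x.
  by move=> _; have [a [s [ms ex]]] := localP pm x; exists s, a; split.
have [Jn0 JnD JnM] := @jpower_submodule R n.+1.
move: x; apply: prod_ideal_ind.
- exists 1, 0; split; [exact: maximal_not1|exact: jpower0|].
  by rewrite mul0r rmorph0.
- move=> x y [s [r [ms Jr ex]]] [s' [r' [ms' Jr' ey]]].
  exists (s * s'), (s' * r + s * r'); split; first exact: prime_not_mul.
    by apply: JnD; exact: JnM.
  by rewrite rmorphD !rmorphM -ex -ey; ring.
move=> x y Jx Jy; have [a [s [ma ms ex]]] : local_max x by rewrite -local_jacobson.
have [s' [r [ms' Jr ey]]] := IH y Jy.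
(* The numerator a is only in m. The factor e carries it into the Jacobson radical of R and is
   harmless in the denominator, being outside m. *)
exists (e * s * s'), (e * a * r); split.
- by apply: prime_not_mul => //; apply: prime_not_mul => //; exact: notin_e.
- by apply: prod_ideal_sub => //; exact: jacobson_e.
- by rewrite !rmorphM -ex -ey; ring.
Qed.

Lemma local_jpower_principal : jpower K `<=` principal u.
Proof.
move=> x /local_jpower[s [r [ms /JK[b eb] ex]]].
have [v sv] := to_local_unit pm ms.
exists (loc_m b * v); rewrite -[LHS]mulr1 -sv mulrA ex eb rmorphM /u; ring.
Qed.

(** The numerator of x may be a zero divisor in R; it is replaced by a regular a + y with the same
    image, as y is killed by the regular x in A. *)
Lemma local_dvd_regular (x : A) : regular x -> exists k, principal x (u ^+ k).
Proof.
move=> rx; have [a [s [ms ex]]] := localP pm x; have [v sv] := to_local_unit pm ms.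
have [y [ay ray]] := regular_add a.
have y0 : loc_m y = 0.
  by apply: rx; rewrite -[LHS]mulr1 -sv mulrACA ex mulrA -rmorphM ay rmorph0 mul0r.
have [k [b eb]] := dvdt ray.
exists k, (loc_m b * loc_m s).
by rewrite /u -rmorphXn eb rmorphM rmorphD y0 addr0 -ex; ring.
Qed.

Lemma local_split (x : A) : exists a w, x = loc_m a + w * u.
Proof.
have [a [s [ms ex]]] := localP pm x; have [k [b [c ek]]] := e_exp ms.
have [v ev] := to_local_unit pm notin_e; have [d ed] := idem_e.
(* In A the element e is a unit and idempotent modulo t, hence 1 modulo t. So b inverts s modulo t,
   and a/s is congruent to a b. *)
have [z ez] : exists z, loc_m (e ^+ k) = 1 + z * u.
  elim: {ek} k => [|k [z ez]]; first by exists 0; rewrite rmorph1 mul0r addr0.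
  have e1 : loc_m e = 1 + loc_m d * v * u.
    have : loc_m (e * e - e) = loc_m d * u by rewrite ed rmorphM.
    rewrite rmorphB rmorphM => e2.
    rewrite mulrAC -e2 mulrBl -mulrA ev; ring.
  by exists (z + loc_m d * v * (1 + z * u)); rewrite exprS rmorphM ez e1; ring.
exists (a * b), (x * (loc_m c - z)).
have bs : loc_m b * loc_m s = 1 + z * u - loc_m c * u.
  by rewrite -ez ek rmorphD !rmorphM addrK.
rewrite rmorphM -ex; transitivity (x * (loc_m b * loc_m s) + x * (loc_m c - z) * u); last by ring.
by rewrite bs; ring.
Qed.

(* Newton's iteration for the polynomial X^2 - X, starting at e. *)
Lemma ex_idempotent : exists eps w, eps * eps = eps /\ eps = to_hat R e + w * th.
Proof.
pose E n := iter n (fun e => 3%:R * e ^+ 2 - 2%:R * e ^+ 3) e.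
(* With E' = 3 E^2 - 2 E^3 one has E'^2 - E' = (E^2 - E)^2 (4 E^2 - 4 E - 3) and E' - E = (E^2 -
   E)(1 - 2 E). Of the quadratic convergence only one factor t per step is kept, to match the digits
   of [hat_series]. *)
have EP n : principal (t ^+ n.+1) (E n * E n - E n).
  elim: n => [|n [b eb]]; first exact: idem_e.
  exists (b ^+ 2 * (4%:R * E n ^+ 2 - 4%:R * E n - 3%:R) * t ^+ n).
  transitivity ((E n * E n - E n) ^+ 2 * (4%:R * E n ^+ 2 - 4%:R * E n - 3%:R)).
    by rewrite /= -/(E n); ring.
  by rewrite eb !exprS; ring.
have /choice[d dP] n : exists d, E n.+1 = E n + d * t ^+ n.+1.
  have [b eb] := EP n; exists (b * (1 - 2%:R * E n)).
  transitivity (E n + (E n * E n - E n) * (1 - 2%:R * E n)).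
    by rewrite /= -/(E n); ring.
  by rewrite eb; ring.
have [s sP] := hat_series Jt d.
have epsE n : to_hat R e + s 0%N * th = to_hat R (E n) + s n * th ^+ n.+1.
  elim: n => [|n ->]; first by rewrite expr1.
  by rewrite dP rmorphD rmorphM rmorphXn -/th sP [th ^+ n.+2]exprS -/th; ring.
exists (to_hat R e + s 0%N * th), (s 0%N); split=> //.
apply/eqP; rewrite -subr_eq0; apply/eqP/(hat_separated Jt) => n.
rewrite (epsE n); have [b eb] := EP n; rewrite -/th.
exists ((to_hat R b + 2%:R * to_hat R (E n) * s n + s n ^+ 2 * th ^+ n.+1 - s n) * th).
have ebh : to_hat R (E n) * to_hat R (E n) = to_hat R (E n) + to_hat R b * th ^+ n.+1.
  by rewrite -rmorphM -[E n * E n](subrK (E n)) eb rmorphD rmorphM rmorphXn addrC.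
transitivity (to_hat R (E n) * to_hat R (E n) - to_hat R (E n) +
  (2%:R * to_hat R (E n) * s n + s n ^+ 2 * th ^+ n.+1 - s n) * th ^+ n.+1); first by ring.
by rewrite ebh exprS; ring.
Qed.

(** * The completion of the localization as a localization of the completion *)

Variable n : set (hat R).
Hypothesis pn : prime_ideal n.
Hypothesis n_m : forall a w, n (to_hat R a + w * th) <-> m a.

(** [eps] cuts out the factor of R^ belonging to n. As it is a multiple of every s outside n,
    fractions over n have representatives with denominator 1; the last property bounds the kernel of
    the projection to the completion of A. *)
Lemma ex_local_idempotent : exists eps, [/\ ~ n eps, eps * eps = eps,
    forall s, ~ n s -> exists b, s * b = eps &
    forall v j, ~ m v -> exists b c, eps = to_hat R v * b + c * th ^+ j].
Proof.
have [eps [w [epsI epsE]]] := ex_idempotent.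
have epsX k : exists w', eps ^+ k = to_hat R e ^+ k + w' * th.
  elim: k => [|k [w' ek]]; first by exists 0; rewrite mul0r addr0.
  by exists (to_hat R e * w' + w * eps ^+ k); rewrite exprS {1}epsE mulrDl {1}ek exprS; ring.
have epsk k : eps * eps ^+ k = eps.
  by elim: k => [|k IH]; rewrite ?mulr1 // exprS mulrA epsI.
have eps1 v : ~ m v -> exists b c, eps = to_hat R v * b + c * th.
  move=> mv; have [k [b [c ek]]] := e_exp mv; have [w' ew] := epsX k.
  exists (eps * to_hat R b), (eps * (to_hat R c + w')).
  by rewrite -{1}(epsk k) ew -rmorphXn ek rmorphD !rmorphM /th; ring.
exists eps; split=> //.
- by rewrite epsE => /n_m; exact: notin_e.
- move=> s ns; have [a [w' es]] := hat_split rt Jt JK s.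
  have [|b [c eb]] := eps1 a; first by move=> ma; apply: ns; rewrite es; exact/n_m.
  have [v cv] := hat_unit Jt unitJ (- (c - w' * b)).
  (* Modulo t, s is a, and b inverts a up to eps. Hence s b eps = eps (1 - (c - w' b) t), whose
     second factor has the inverse v. *)
  exists (b * eps * v).
  have eps2 : eps = s * b + (c - w' * b) * th by rewrite es /th [LHS]eb; ring.
  have e1 : eps * (1 + - (c - w' * b) * th) = s * b * eps.
    transitivity (eps - (c - w' * b) * th * eps); first by ring.
    by rewrite -{1}epsI {1}eps2; ring.
  by rewrite !mulrA -e1 -mulrA cv mulr1.
move=> v j mv; have [b [c eb]] := eps1 v mv.
elim: j => [|j [b' [c' ej]]]; first by exists 0, eps; rewrite mulr0 add0r mulr1.
exists (b' * eps + c' * th ^+ j * b), (c' * c).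
transitivity (to_hat R v * b' * eps + c' * th ^+ j * (to_hat R v * b + c * th)).
  by rewrite -eb -mulrDl -ej epsI.
by rewrite exprS; ring.
Qed.

(* The graph of the projection from R^ to the completion of its localization A
   at m: the image of R is dense on both sides. *)
Definition agree (x : hat R) (y : hat A) : Prop := forall j, exists r,
  principal (th ^+ j) (x - to_hat R r) /\ principal (uh ^+ j) (y - to_hat A (loc_m r)).

Lemma agree_to_hat a : agree (to_hat R a) (to_hat A (loc_m a)).
Proof. by move=> j; exists a; rewrite !subrr; split; exists 0; rewrite mul0r. Qed.

Lemma agreeB x y x' y' : agree x y -> agree x' y' -> agree (x - x') (y - y').
Proof.
move=> h h' j; have [r [p q]] := h j; have [r' [p' q']] := h' j.
exists (r - r'); rewrite !rmorphB.
rewrite [x - x' - _](_ : _ = x - to_hat R r - (x' - to_hat R r')); last by ring.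
rewrite [y - y' - _](_ : _ = y - to_hat A (loc_m r) - (y' - to_hat A (loc_m r'))); last by ring.
by split; apply: idealB => //; exact: principal_ideal.
Qed.

Lemma agreeM x y x' y' : agree x y -> agree x' y' -> agree (x * x') (y * y').
Proof.
move=> h h' j; have [r [p q]] := h j; have [r' [p' q']] := h' j.
exists (r * r'); rewrite !rmorphM.
rewrite [x * x' - _](_ : _ = (x - to_hat R r) * x' + to_hat R r * (x' - to_hat R r')); last by ring.
rewrite [y * y' - _](_ : _ = (y - to_hat A (loc_m r)) * y' +
  to_hat A (loc_m r) * (y' - to_hat A (loc_m r'))); last by ring.
have ip1 := principal_ideal (th ^+ j); have ip2 := principal_ideal (uh ^+ j).
by split; apply: idealD => //; [exact: idealMl|exact: idealMr|exact: idealMl|exact: idealMr].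
Qed.

Let ru := local_regular.
Let Ju := local_jacobson_t.
Let JuK := local_jpower_principal.

(** Expansions with the same digits in R agree, the common approximations being the partial sums.
    Digits can be extracted on either side and resummed on the other. *)
Lemma agree_of_digits r (x : nat -> hat R) (y : nat -> hat A) :
  (forall k, x k = to_hat R (r k) + x k.+1 * th) ->
  (forall k, y k = to_hat A (loc_m (r k)) + y k.+1 * uh) -> agree (x 0%N) (y 0%N).
Proof.
move=> xP yP j; exists (\sum_(k < j) r k * t ^+ k).
rewrite (telescope xP j) (@telescope _ _ (to_hat A \o loc_m) t r y yP j) /= -/th -/u -/uh.
by split; [exists (x j)|exists (y j)]; rewrite addrAC subrr add0r.
Qed.

Lemma ex_agree_l x : exists y, agree x y.
Proof.
have /choice[g gP] (z : hat R) : exists aw, z = to_hat R aw.1 + aw.2 * th.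
  by have [a [w ->]] := hat_split rt Jt JK z; exists (a, w).
pose z k := iter k (fun z => (g z).2) x.
have [s sP] := hat_series Ju (fun k => loc_m (g (z k)).1).
exists (s 0%N); exact: (@agree_of_digits (fun k => (g (z k)).1) z s).
Qed.

Lemma ex_agree_r y : exists x, agree x y.
Proof.
have /choice[g gP] (z : hat A) : exists aw, z = to_hat A (loc_m aw.1) + aw.2 * uh.
  have [a [w ->]] := hat_split ru Ju JuK z; have [b [v ->]] := local_split a.
  exists (b, to_hat A v + w) => /=.
  by rewrite rmorphD rmorphM -/uh; ring.
pose z k := iter k (fun z => (g z).2) y.
have [s sP] := hat_series Jt (fun k => (g (z k)).1).
exists (s 0%N); exact: (@agree_of_digits (fun k => (g (z k)).1) s z).
Qed.

Lemma agree0l y : agree 0 y -> y = 0.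
Proof.
move=> h; apply: (hat_separated Ju) => j; have [r [p q]] := h j.
have [|b eb] := @hat_principalX R t K j r rt Jt JK.
  by case: p => w ew; exists (- w); rewrite mulNr -ew sub0r opprK.
rewrite -[y](subrK (to_hat A (loc_m r))); apply: idealD => //; first exact: principal_ideal.
by exists (to_hat A (loc_m b)); rewrite eb !rmorphM !rmorphXn.
Qed.

(** Modulo t^j, x is some r in R whose image in A is divisible by t^j; so v s r is in t^j R for some
    v s outside m. As eps lies in v s R^ + t^j R^, the product eps x lies in every t^j R^. *)
Lemma agree0r x eps : agree x 0 ->
  (forall v j, ~ m v -> exists b c, eps = to_hat R v * b + c * th ^+ j) -> eps * x = 0.
Proof.
move=> h epsP; apply: (hat_separated Jt) => j; have [r [p q]] := h j.
have [|y ey] := @hat_principalX A u K j (loc_m r) ru Ju JuK.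
  by case: q => w ew; exists (- w); rewrite mulNr -ew sub0r opprK.
have [a [s [ms es]]] := localP pm y.
have : loc_m (r * s - a * t ^+ j) = 0.
  by rewrite rmorphB !rmorphM ey -es rmorphXn -/u; apply/eqP; rewrite subr_eq0; apply/eqP; ring.
case/(to_local_eq0 pm) => v mv evs.
have [|b [c eb]] := epsP (v * s) j; first exact: prime_not_mul.
have ip := principal_ideal (th ^+ j).
have -> : eps * x = eps * (x - to_hat R r) + eps * to_hat R r by ring.
apply: idealD => //; first exact: idealMr.
have vsr : to_hat R (v * s) * to_hat R r = to_hat R (v * a) * th ^+ j.
  rewrite -rmorphM -rmorphXn -rmorphM; congr (to_hat R _).
  by apply/eqP; rewrite -subr_eq0 -[X in _ == X]evs; apply/eqP; ring.
exists (to_hat R (v * a) * b + c * to_hat R r).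
rewrite {1}eb.
transitivity (to_hat R (v * s) * to_hat R r * b + c * th ^+ j * to_hat R r); first by ring.
by rewrite vsr; ring.
Qed.

Lemma agree_regular x y : agree x y -> ~ n x -> regular y.
Proof.
move=> h nx; have [r [[w ew] [w' ew']]] := h 1%N; rewrite !expr1 in ew ew'.
have mr : ~ m r.
  by move=> mr; apply: nx; rewrite -[x](subrK (to_hat R r)) ew addrC; exact/n_m.
have [v rv] := to_local_unit pm mr.
have unitA := local_jacobson_unit pm.
have [v' wv'] := hat_unit Ju unitA (w' * to_hat A v).
apply: (@regular_unit _ _ (to_hat A v * v')); rewrite mulrA.
transitivity ((1 + w' * to_hat A v * uh) * v'); last exact: wv'.
congr (_ * v').
rewrite -[y](subrK (to_hat A (loc_m r))) ew' mulrDl -rmorphM rv rmorph1; ring.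
Qed.

(** [theta] sends y to x/1 for any x that agrees with y; the ambiguity in x is killed by eps, which
    is outside n. Injectivity: if s outside n kills x, the partner of s is regular and kills y.
    Surjectivity: x/s equals x b, where s b = eps becomes 1. *)
Lemma ex_theta : exists theta : {rmorphism hat A -> local_at n},
  bijective theta /\ forall a, theta (to_hat A (loc_m a)) = to_local n (to_hat R a).
Proof.
have [eps [neps epsI epsD epsP]] := ex_local_idempotent.
have [|||||theta thetaP] := @rmorph_of_rel (hat A) (local_at n)
    (fun y z => exists2 x, agree x y & z = to_local n x).
- by move=> y; have [x xy] := ex_agree_r y; exists (to_local n x), x.
- exists 1; last by rewrite rmorph1.
  by have := agree_to_hat 1; rewrite !rmorph1.
- move=> y z y' z' [x xy ->] [x' xy' ->]; exists (x - x'); first exact: agreeB.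
  by rewrite rmorphB.
- move=> y z y' z' [x xy ->] [x' xy' ->]; exists (x * x'); first exact: agreeM.
  by rewrite rmorphM.
- move=> z [x x0 ->]; apply/(to_local_eq0 pn); exists eps => //.
  exact: agree0r.
exists theta; split; last first.
  by move=> a; apply/esym/thetaP; exists (to_hat R a) => //; exact: agree_to_hat.
have theta_inj : injective theta.
  apply: raddf_inj => y y0.
  have [x xy /esym] : exists2 x, agree x y & 0 = to_local n x by apply/thetaP; rewrite y0.
  case/(to_local_eq0 pn) => s ns sx.
  have [y' sy'] := ex_agree_l s.
  apply: (agree_regular sy' ns); apply: agree0l.
  by rewrite -sx; exact: agreeM.
have /choice[g gP] z : exists y, theta y = z.
  have [x [s [ns ez]]] := localP pn z; have [b sb] := epsD s ns.
  have eps1 : to_local n eps = 1.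
    apply/eqP; rewrite -subr_eq0 -(rmorph1 (to_local n)) -rmorphB; apply/eqP/(to_local_eq0 pn).
    by exists eps => //; rewrite mulrBr mulr1 epsI subrr.
  have [y xby] := ex_agree_l (x * b).
  exists y; apply/esym/thetaP; exists (x * b) => //.
  by rewrite rmorphM -ez -mulrA -rmorphM sb eps1 mulr1.
by exists g => y //; apply: theta_inj.
Qed.

End LocalCompletion.

Lemma analytically_reduced_reduced (R : comPzRingType) :
  noetherian R -> analytically_reduced R -> reduced R.
Proof.
move=> noethR hred x n xn; apply: (krull_intersection noethR); apply/to_hat_eq0.
by apply: (hred _ n); rewrite -rmorphXn xn rmorph0.
Qed.

Lemma total_frac_von_neumann (R : comPzRingType) : noetherian R -> reduced R ->
  forall x : total_frac R, exists y, x * x * y = x.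
Proof.
move=> noethR redR x; have [a [s [rs ex]]] := fracP x.
have [y [ay ray]] := ex_regular_add noethR redR a.
have [v av] := to_frac_unit ray; have [w sw] := to_frac_unit rs.
(* The weak inverse of a/s is s/(a+y), because a (a+y) = a^2. *)
exists (to_frac R s * v).
transitivity (to_frac R (a * (a + y)) * v * w).
  have -> : a * (a + y) = a * a by rewrite mulrDr ay addr0.
  rewrite rmorphM -ex.
  transitivity (x * x * to_frac R s * v * (to_frac R s * w)); last by ring.
  by rewrite sw mulr1 mulrA.
rewrite rmorphM -[X in X * w]mulrA av mulr1 -ex -mulrA sw mulr1 //.
Qed.

(** * Each valuation ring is identified with its extension *)

Section Identification.
Variable R : comPzRingType.
Hypothesis hR : semilocal_cohen_macaulay_dim1 R.
Hypothesis hred : analytically_reduced R.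

Let noethR := scm_noetherian hR.
Let dimR := scm_dim hR.
Let redR := analytically_reduced_reduced noethR hred.
Let von_neumann := total_frac_von_neumann noethR redR.

Variables (t : R) (K : nat).
Hypothesis Jt : jacobson t.
Hypothesis rt : regular t.
Hypothesis JK : jpower K `<=` principal t.

Let dvdt r : regular r -> exists k, principal r (t ^+ k) := dvd_regular_exp noethR dimR Jt (r := r).

Let rth : regular (to_hat R t) := hat_regular rt Jt JK.

Lemma to_hat_dvd_regular_exp r : regular r -> exists k, principal r (to_hat R t ^+ k).
Proof. by apply: (hat_dvd_regular_exp noethR rt Jt JK) => D; exact: artinian_principal. Qed.

Let dvdth := to_hat_dvd_regular_exp.

Lemma to_hat_inj : injective (to_hat R).
Proof.
by apply: raddf_inj => a /to_hat_eq0; exact: krull_intersection.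
Qed.

Lemma identified_extend V : valuation_rings R V -> identified V (extend (to_hat R) V).
Proof.
move=> vV; have to_hat_regular := f_regular rth dvdt.
have [i iE] := ex_frac_map to_hat_regular.
have splitR := hat_split rt Jt JK; have prinR := hat_principal JK.
have pm := center_prime rt dvdt von_neumann vV.
have maxm : Max R (center V).
  exact: (prime_regular_maximal noethR dimR pm (center_t rt dvdt von_neumann vV) rt).
have [e [idem_e m1e e_exp]] := ex_idempotent_mod noethR dimR (scm_semilocal hR) Jt rt maxm.
have pn := center_ext_prime rt rth dvdt dvdth splitR prinR iE von_neumann vV.
have n_m a w := center_ext rt rth dvdt dvdth splitR prinR iE von_neumann a w vV.
have [theta [theta_bij thetaE]] := ex_theta rt Jt JK
  (@jacobson_unit R noethR) maxm idem_e m1e e_exp pn n_m.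
have local_reg : forall s, regular s -> regular (to_local (center V) s).
  by move=> s; exact: to_local_regular.
have hat_local_reg : forall s : local_at (center V), regular s -> regular (to_hat _ s).
  apply: (f_regular (t := to_local (center V) t)).
    apply: (hat_regular (K := K)); first exact: local_reg.
      exact: local_jacobson_t.
    exact: (local_jpower_principal Jt JK maxm m1e e_exp).
  exact: (local_dvd_regular dvdt (ex_regular_add noethR redR) maxm).
have theta_reg : forall s, regular s -> regular (theta s).
  have [g thetaK gK] := theta_bij => s rs y; rewrite -[y]gK -rmorphM => sy.
  have /(can_inj thetaK)/rs -> : theta (s * g y) = theta 0 by rewrite sy rmorph0.
  exact: rmorph0.
have n_reg : forall s, regular s -> regular (to_local (center (extend (to_hat R) V)) s).
  by move=> s; exact: to_local_regular.
exists theta; split=> //.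
(* The two routes from R, through the completion of R_m followed by theta and through R^, have the
   same composite [h']. *)
pose h : {rmorphism R -> _} := to_hat (local_at (center V)) \o to_local (center V).
pose h' : {rmorphism R -> _} :=
  to_local (center (extend (to_hat R) V)) \o to_hat R.
rewrite (extend_comp (h := h)) // (extend_comp (h := h')) //; last first.
  by move=> s rs; apply: hat_local_reg; exact: local_reg.
by rewrite (extend_comp (h := h')).
Qed.

End Identification.

Theorem theorem3p3p5 (R : comPzRingType)
    (hR : semilocal_cohen_macaulay_dim1 R)
    (hred : analytically_reduced R)
    (hres : large_residue_fields R) :
  exists phi : valuation_rings R -> valuation_rings (hat R),
    [/\ bijective phi,
        forall V : valuation_rings R, identified (sval V) (sval (phi V))
      & forall E : set (total_frac R), regular_fractional_ideal E ->
          Gamma E =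
          [set (beta \o phi)%FUN | beta in Gamma (extend (to_hat R) E)]].
Proof.
have noethR := scm_noetherian hR; have dimR := scm_dim hR.
have redR := analytically_reduced_reduced noethR hred.
have [t Jt rt] := ex_regular_jacobson noethR redR (scm_semilocal hR) (scm_depth hR).
have [K JK] := jpower_sub_regular noethR dimR rt.
have dvdt r : regular r -> exists k, principal r (t ^+ k) by exact: dvd_regular_exp.
have rth := hat_regular rt Jt JK.
have dvdth := to_hat_dvd_regular_exp hR Jt rt JK.
have [i iE] := ex_frac_map (f_regular rth dvdt).
have splitR := hat_split rt Jt JK; have prinR := hat_principal JK.
have [phi [phi_bij phiE]] := ex_phi rt rth dvdt dvdth splitR prinR iE.
exists phi; split=> // [V|E [[mE _] _]].
  by rewrite phiE; apply: (identified_extend hR hred Jt rt JK); exact: set_mem (svalP V).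
apply: (Gamma_ext rt rth dvdt dvdth (to_hat_inj hR) splitR prinR _ iE) => //.
  exact: hat_unit Jt (@jacobson_unit R noethR).
exact: total_frac_von_neumann.
Qed.
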